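(* Let $X\subset\mathrm{Hol}(\mathbb{D})$ be a complex Banach space of holomorphic functions on $\mathbb{D}$ (a linear subspace of $\mathrm{Hol}(\mathbb{D})$ equipped with a complete norm $\|\cdot\|_X$) such that: (X1) the inclusion map $X\to\mathrm{Hol}(\mathbb{D})$ is continuous; (X2) the polynomials are contained in $X$ and are dense in $X$; (X3) $\limsup_{n\to\infty}\|z^n\|_X^{1/n}\le 1$. Let $T:X\to\mathrm{Hol}(\mathbb{D})$ be a continuous linear map that maps finite Blaschke products to inner functions. (i) If $\dim(T(X))>1$, then there exist inner functions $\phi,\psi$, with $\phi$ non-constant, such that $$Tf=\psi\cdot(f\circ\phi)\quad\text{for all } f\in X.$$ (ii) If $\dim(T(X))=1$, then there exist an inner function $\psi$ and a point $\alpha\in\mathbb{T}$ such that $$Tf=f(\alpha)\,\psi\quad\text{for all } f\in X\cap\mathrm{Hol}(\overline{\mathbb{D}}).$$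
   Context: $\mathbb{D}$ is the open unit disk in $\mathbb{C}$ and $\mathbb{T}$ is the unit circle. $\mathrm{Hol}(\mathbb{D})$ is the space of holomorphic functions on $\mathbb{D}$ with the topology of uniform convergence on compact sets. $\mathrm{Hol}(\overline{\mathbb{D}})$ is the set of functions holomorphic on a neighborhood of $\overline{\mathbb{D}}$ (viewed as functions on $\mathbb{D}$ by restriction). A function $h\in\mathrm{Hol}(\mathbb{D})$ is called inner if it is bounded and its radial limits $h^*(e^{it}):=\lim_{r\to1^-}h(re^{it})$ satisfy $|h^*(e^{it})|=1$ for a.e. $e^{it}\in\mathbb{T}$. In particular unimodular constants are inner, and a non-constant inner function maps $\mathbb{D}$ into $\mathbb{D}$. A finite Blaschke product is a function of the form $B(z)=c\prod_{n=1}^{N}\frac{a_n-z}{1-\overline{a_n}z}$ with $N\ge 0$, $a_1,\dots,a_N\in\mathbb{D}$ and $c$ a unimodular constant (so unimodular constants, $N=0$, are included). The conditions (X1)--(X3) imply that $X$ contains all rational functions with poles outside $\overline{\mathbb{D}}$, and in particular all finite Blaschke products. *)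

(* Defs.v *)
From HB Require Import structures.
From mathcomp Require Import all_boot all_order all_algebra.
From mathcomp Require Import all_classical all_reals all_analysis.
From mathcomp Require Import complex.

Set Implicit Arguments.
Unset Strict Implicit.
Unset Printing Implicit Defensive.

Import Order.TTheory GRing.Theory Num.Theory.
Import numFieldNormedType.Exports.

Local Open Scope classical_set_scope.
Local Open Scope complex_scope.
Local Open Scope ring_scope.

(* MathComp-Analysis equips every abstract numFieldType with its own norm
   topology, but not the concrete type R[i]. *)
HB.instance Definition _ (R : realType) :=
  PseudoPointedMetric.copy R[i] (R[i])^o.
HB.instance Definition _ (R : realType) := NormedModule.copy R[i] (R[i])^o.

Section Disc.
Variable R : realType.
Local Notation C := R[i].

Definition disc : set C := [set z | `|z| < 1].
Definition closed_disc : set C := [set z | `|z| <= 1].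

(* Since C is taken as a normed space over itself, derivability in the
   direction 1 is the existence of the complex derivative. *)
Definition holomorphic (U : set C) (f : C -> C) : Prop :=
  forall z, U z -> derivable f z 1.

(* A function on the disc is represented by its extension by 0 to C, so that
   equality in [hol] is equality on the disc. *)
Definition hol_pred : {pred (C -> C)} :=
  fun f => `[< holomorphic disc f /\ (forall z, ~ disc z -> f z = 0) >].

Lemma hol_submod_closed : submod_closed hol_pred.
Proof.
split.
  by apply/asboolP; split=> // z _; exact: derivable_cst.
move=> a f g /asboolP[df f0] /asboolP[dg g0]; apply/asboolP; split=> z Dz.
  by apply: derivableD; [apply: derivableZ; exact: df | exact: dg].
by rewrite !fctE f0// g0// scaler0 addr0.
Qed.

HB.instance Definition _ :=
  GRing.isSubmodClosed.Build C (C -> C) hol_pred hol_submod_closed.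

Record hol := Hol { hol_fun :> C -> C; hol_funP : hol_fun \in hol_pred }.

HB.instance Definition _ := [isSub for hol_fun].
HB.instance Definition _ := [Choice of hol by <:].
HB.instance Definition _ := [SubChoice_isSubLmodule of hol by <:].

Definition compact_in_disc (K : set C) : Prop := compact K /\ K `<=` disc.

HB.instance Definition _ := Topological.copy hol
  (initial_topology (hol_fun : hol -> {family compact_in_disc, C -> C})).

Definition inner (h : hol) : Prop :=
  (exists M : R, forall z, disc z -> `|h z| <= M%:C) /\
  {ae lebesgue_measure, forall t : R, t \in `[0, 2 * pi[ ->
     exists2 l : C,
       h (r%:C * (cos t +i* sin t)) @[r --> (1 : R)^'-] --> l & `|l| = 1}.

Definition finite_blaschke (h : hol) : Prop :=
  exists (c : C) (a : seq C),
    [/\ `|c| = 1, (forall b, b \in a -> disc b) &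
        forall z, disc z ->
          h z = c * \prod_(b <- a) ((b - z) / (1 - b^* * z))].

Definition constant_on_disc (h : hol) : Prop :=
  exists c : C, forall z, disc z -> h z = c.

Definition holomorphic_extension (f : hol) (g : C -> C) : Prop :=
  (exists U : set C, [/\ open U, closed_disc `<=` U & holomorphic U g]) /\
  (forall z, disc z -> f z = g z).

Definition is_polynomial (f : hol) (p : {poly C}) : Prop :=
  forall z, disc z -> f z = p.[z].

Definition linearly_independent (V : lmodType C) (n : nat) (v : 'I_n -> V) :
  Prop :=
  forall c : 'I_n -> C, \sum_(i < n) c i *: v i = 0 -> forall i, c i = 0.

(* Dimension of a linear subspace; +oo when it is infinite-dimensional. *)
Definition dimension (V : lmodType C) (A : set V) : \bar R :=
  ereal_sup [set (n%:R)%:E | n in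
    [set n : nat | exists v : 'I_n -> V,
                     (forall i, A (v i)) /\ linearly_independent v]].

End Disc.

(* The norm of a normed space over R[i] takes its values in R[i]; they are
   nonnegative reals. *)
Definition rnorm (R : realType) (X : normedModType R[i]) (x : X) : R :=
  complex.Re `|x|.

(* A Banach space X included in Hol(D) is given as an abstract complete normed
   space together with its inclusion map [inc]. *)
Record banach_hol_space (R : realType) (X : completeNormedModType R[i])
    (inc : {linear X -> hol R}) : Prop := BanachHolSpace {
  inc_injective : injective inc;
  inc_continuous : continuous inc;
  polynomial_mem : forall p : {poly R[i]}, exists f : X, is_polynomial (inc f) p;
  polynomial_dense :
    dense [set f : X | exists p : {poly R[i]}, is_polynomial (inc f) p];
  monomial_limsup : forall e : nat -> X,
    (forall n, is_polynomial (inc (e n)) 'X^n) ->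
    (limn_esup (fun n => (rnorm (e n) `^ (n%:R^-1))%:E) <= 1)%E
}.

(* Main.v *)
(* Put u_k = T(z^k).  For a.e. boundary point, and for a = s or a = i s with
   s = 1/2, 1/3, ..., the radial limits of u_k and of
   T(z^k (a - z)/(1 - conj(a) z)) = a u_k - u_(k+1) - conj(a) u_(k+2) + O(s^2)
   are unimodular; the first-order term in s then forces
   u_k u_(k+2) = u_(k+1)^2 at that point.  Hence u_k u_0^k = u_1^k u_0 on the
   circle, so on the disc, and since |u_k| <= 1 for all k the quotient u_1/u_0
   is bounded by 1: its singularities are removable, it is an inner function phi,
   and T(z^k) = u_0 phi^k.  Density of the polynomials gives the weighted
   composition formula if phi is not constant; if phi is a constant alpha, T has
   rank one and the Taylor series of f, which converges in X when f is
   holomorphic across the circle, gives T f = f(alpha) u_0. *)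
Require Import Defs.
From HB Require Import structures.
From mathcomp Require Import all_boot all_order all_algebra.
From mathcomp Require Import all_classical all_reals all_analysis.
From mathcomp Require Import complex ring lra.

Set Implicit Arguments.
Unset Strict Implicit.
Unset Printing Implicit Defensive.

Import Order.TTheory GRing.Theory Num.Theory.
Import numFieldNormedType.Exports.

Local Open Scope classical_set_scope.
Local Open Scope complex_scope.
Local Open Scope ring_scope.

(** * Convergence and differentiability in R[i] *)

(* Unification of the library lemmas below does not terminate on R[i], hence the
   detour through an abstract field. *)
Section Generic.
Variable K : numFieldType.

(** The exceptional null set on the circle depends on the function tested, so only countably many
    Blaschke products may be used; two sequences of parameters tending to 0 suffice. Let x, y, w be
    the radial limits of u_k, u_(k+1), u_(k+2). Along [a = s] the first-order term says Re (conj(y)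
    (x - w)) = 0, along [a = i s] it says Im (conj(y) (x + w)) = 0; so conj(y) w is the conjugate of
    conj(y) x, which for unimodular numbers means x w = y^2. The growth condition on the norms of
    z^n is what puts these products in X as sums of their power series, so that T acts on them term
    by term and the remainder can be estimated. The passage from the circle to the disc rests on one
    fact: a bounded holomorphic function whose radial limits have modulus at most M almost
    everywhere is bounded by M. It comes from Cauchy's formula with crude constants, which taking
    powers then removes. The relation between u_k, u_0 and u_1 is kept free of division because u_0
    may have zeros. Where it has none, |u_0| |u_1/u_0|^k = |u_k| <= 1 for all k, and this excludes a
    quotient of modulus greater than 1. *)

Lemma num_cvgP (T : Type) (F : set_system T) (FF : Filter F) (f : T -> K) (l : K) :
  f @ F --> l <-> forall e : K, 0 < e -> \forall x \near F, `|l - f x| < e.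
Proof. exact: cvgrPdist_lt. Qed.

Lemma num_cvgM (T : Type) (F : set_system T) (FF : Filter F)
    (f g : T -> K) (l m : K) :
  f @ F --> l -> g @ F --> m -> (fun x => f x * g x) @ F --> l * m.
Proof. by move=> a b; apply: cvgM. Qed.

Lemma num_cvgD (T : Type) (F : set_system T) (FF : Filter F)
    (f g : T -> K) (l m : K) :
  f @ F --> l -> g @ F --> m -> (fun x => f x + g x) @ F --> l + m.
Proof. by move=> a b; apply: cvgD. Qed.

Lemma num_cvgB (T : Type) (F : set_system T) (FF : Filter F)
    (f g : T -> K) (l m : K) :
  f @ F --> l -> g @ F --> m -> (fun x => f x - g x) @ F --> l - m.
Proof. by move=> a b; apply: cvgB. Qed.

Lemma num_cvgV (T : Type) (F : set_system T) (FF : Filter F)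
    (f : T -> K) (l : K) : l != 0 ->
  f @ F --> l -> (fun x => (f x)^-1) @ F --> l^-1.
Proof. by move=> l0 fl; apply: cvgV. Qed.

Lemma num_cvg_unique (T : Type) (F : set_system T) (FF : ProperFilter F)
    (f : T -> K) (l m : K) : f @ F --> l -> f @ F --> m -> l = m.
Proof. by move=> a b; apply: cvg_unique a b. Qed.

Lemma num_nbhsP (z : K) (A : set K) :
  nbhs z A <-> exists2 d : K, 0 < d & forall w, `|w - z| < d -> A w.
Proof.
split=> [/nbhs_ballP[d /= d0 dA]|[d d0 dA]].
  by exists d => // w wd; apply: dA; rewrite /ball /= distrC.
by apply/nbhs_ballP; exists d => //= w wd; apply: dA; rewrite distrC.
Qed.

Lemma num_derivableM (f g : K -> K) (z : K) : derivable f z 1 -> derivable g z 1 ->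
  derivable (fun w => f w * g w) z 1.
Proof. by move=> a b; apply: derivableM. Qed.

Lemma num_derivableB (f g : K -> K) (z : K) : derivable f z 1 ->
  derivable g z 1 -> derivable (fun w => f w - g w) z 1.
Proof. by move=> a b; apply: derivableB. Qed.

Lemma num_derivableV (f : K -> K) z : f z != 0 -> derivable f z 1 ->
  derivable (fun w => (f w)^-1) z 1.
Proof. by move=> f0 a; apply: derivableV. Qed.

Lemma num_derivable_cst (c z : K) : derivable (fun=> c : K) z 1.
Proof. exact: derivable_cst. Qed.

Lemma num_derivable_id (z : K) : derivable (fun w : K => w) z 1.
Proof. exact: derivable_id. Qed.

Lemma num_derivableP (f : K -> K) (z : K) : derivable f z 1 <->
  exists d : K, forall e : K, 0 < e -> exists2 r : K, 0 < r &
    forall w, `|w - z| < r -> `|f w - f z - d * (w - z)| <= e * `|w - z|.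
Proof.
split.
  move=> /derivable1_diffP/derivable1_diffP /cvg_ex[d fd]; exists d => e e0.
  move: fd => /cvgrPdist_lt /(_ _ e0); rewrite near_withinE.
  move=> /num_nbhsP[r r0 rP]; exists r => // w wr.
  have [->|wz] := eqVneq w z; first by rewrite !subrr mulr0 subr0 normr0 mulr0.
  have wz0 : w - z != 0 by rewrite subr_eq0.
  have := rP (w - z); rewrite subr0 => /(_ wr wz0) /ltW.
  rewrite /= scaler1 subrK /GRing.scale /=.
  move=> /(ler_wpM2r (normr_ge0 (w - z))); rewrite -normrM mulrBl.
  by rewrite mulrAC mulVf// mul1r distrC.
move=> [d dP]; apply/cvg_ex; exists d; apply/cvgrPdist_lt => e e0.
rewrite near_withinE; apply/num_nbhsP.
(* The limit asks for a strict inequality while [dP] gives a weak one, hence half of [e]. *)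
have [r r0 rP] := dP (e / 2) (divr_gt0 e0 (ltr0Sn K 1)).
exists r => // h; rewrite subr0 => hr h0.
have := rP (h + z); rewrite addrK => /(_ hr).
rewrite /= scaler1 /GRing.scale /= => H.
have -> : d - h^-1 * (f (h + z) - f z) = - h^-1 * (f (h + z) - f z - d * h).
  by field.
rewrite normrM normrN normfV ltr_pdivrMl ?normr_gt0//.
apply: (le_lt_trans H); rewrite mulrC ltr_pM2l ?normr_gt0//.
by rewrite ltr_pdivrMr// ltr_pMr// ltr1n.
Qed.

End Generic.

(** The norm of [R[i]] takes its values in [R[i]]; the estimates below need an ordered real value.
    The lock keeps simplification from opening the modulus into a square root of coordinates. *)
HB.lock Definition cabs (R : realType) (z : R[i]) : R := Normc.normc z.

Section ComplexNorm.
Variable R : realType.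
Local Notation C := R[i].

Lemma normr_cabs (z : C) : `|z| = (cabs z)%:C.
Proof. by rewrite cabs.unlock; case: z. Qed.
Lemma cabs_ge0 (z : C) : 0 <= cabs z.
Proof. by rewrite -lecR -normr_cabs normr_ge0. Qed.
Lemma cabs0 : cabs (0 : C) = 0.
Proof. by rewrite cabs.unlock; exact: Normc.normc0. Qed.
Lemma cabs1 : cabs (1 : C) = 1.
Proof. by rewrite cabs.unlock; exact: Normc.normc1. Qed.
Lemma cabs_i : cabs ('i%C : C) = 1.
Proof. by rewrite cabs.unlock /= expr0n expr1n add0r sqrtr1. Qed.
Lemma cabsM (z w : C) : cabs (z * w) = cabs z * cabs w.
Proof. by rewrite cabs.unlock; exact: Normc.normcM. Qed.
Lemma cabsV (z : C) : cabs z^-1 = (cabs z)^-1.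
Proof. by rewrite cabs.unlock; exact: Normc.normcV. Qed.
Lemma cabsX (z : C) n : cabs (z ^+ n) = cabs z ^+ n.
Proof. by elim: n => [|n IH]; rewrite ?expr0 ?cabs1// !exprS cabsM IH. Qed.
Lemma cabsN (z : C) : cabs (- z) = cabs z.
Proof. by rewrite cabs.unlock; exact: normcN. Qed.
Lemma cabs_distC (z w : C) : cabs (z - w) = cabs (w - z). Proof. by rewrite -cabsN opprB. Qed.
Lemma cabsD_le (z w : C) : cabs (z + w) <= cabs z + cabs w.
Proof. by rewrite cabs.unlock; exact: le_normcD. Qed.
Lemma cabsB_le (z w : C) : cabs (z - w) <= cabs z + cabs w.
Proof. by apply: (le_trans (cabsD_le _ _)); rewrite cabsN. Qed.
Lemma cabs_triangle (x y z : C) : cabs (x - z) <= cabs (x - y) + cabs (y - z).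
Proof. by apply: le_trans (cabsD_le _ _); rewrite subrKA. Qed.
Lemma cabs_lerB (z w : C) : cabs z - cabs w <= cabs (z - w).
Proof. by rewrite lerBlDr; apply: le_trans (cabsD_le _ _); rewrite subrK. Qed.
Lemma cabs_eq0 (z : C) : (cabs z == 0) = (z == 0).
Proof. by apply/eqP/eqP => [|->]; [rewrite cabs.unlock => /Normc.eq0_normc|exact: cabs0]. Qed.
Lemma cabs_gt0 (z : C) : (0 < cabs z) = (z != 0).
Proof. by rewrite lt0r cabs_ge0 andbT cabs_eq0. Qed.
Lemma cabs_real (x : R) : cabs x%:C = `|x|.
Proof. by rewrite cabs.unlock /= expr0n /= addr0 sqrtr_sqr. Qed.
Lemma cabs_sqr (z : C) : cabs z ^+ 2 = complex.Re z ^+ 2 + complex.Im z ^+ 2.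
Proof. by rewrite cabs.unlock; case: z => a b; rewrite sqr_sqrtr// addr_ge0 ?sqr_ge0. Qed.
Lemma cabs_sum_le (I : Type) (s : seq I) (P : pred I) (F : I -> C) :
  cabs (\sum_(i <- s | P i) F i) <= \sum_(i <- s | P i) cabs (F i).
Proof.
elim/big_rec2: _ => [|i x y _ H]; first by rewrite cabs0.
by apply: (le_trans (cabsD_le _ _)); rewrite lerD2l.
Qed.
Lemma cabs_ge_Re (z : C) : `|complex.Re z| <= cabs z.
Proof.
rewrite -(@ler_pXn2r _ 2) ?nnegrE ?cabs_ge0 ?normr_ge0//.
by rewrite cabs_sqr real_normK ?num_real// lerDl sqr_ge0.
Qed.
Lemma cabs_ge_Im (z : C) : `|complex.Im z| <= cabs z.
Proof.
rewrite -(@ler_pXn2r _ 2) ?nnegrE ?cabs_ge0 ?normr_ge0//.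
by rewrite cabs_sqr real_normK ?num_real// lerDr sqr_ge0.
Qed.
Lemma cabs_le_ReIm (z : C) : cabs z <= `|complex.Re z| + `|complex.Im z|.
Proof.
rewrite -(@ler_pXn2r _ 2) ?nnegrE ?cabs_ge0 ?addr_ge0 ?normr_ge0//.
rewrite cabs_sqr sqrrD !real_normK ?num_real//.
have := mulr_ge0 (normr_ge0 (complex.Re z)) (normr_ge0 (complex.Im z)).
lra.
Qed.

Lemma gt0_complexP (e : C) : 0 < e -> exists2 r : R, 0 < r & e = r%:C.
Proof.
case: e => a b; rewrite ltcE /= => /andP[/eqP b0 a0].
by exists a => //; rewrite b0.
Qed.

Lemma cvgC_cabsP (T : Type) (F : set_system T) (FF : Filter F) (f : T -> C) (l : C) :
  f @ F --> l <-> forall e : R, 0 < e -> \forall x \near F, cabs (f x - l) < e.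
Proof.
split.
  move=> /(num_cvgP (K := C) FF) fl e e0.
  have e0' : 0 < e%:C by rewrite ltcR.
  have := fl _ e0'; apply: filterS => x.
  by rewrite normr_cabs ltcR cabs_distC.
move=> H; apply/(num_cvgP (K := C) FF) => e /gt0_complexP[r r0 ->].
have := H _ r0; apply: filterS => x.
by rewrite normr_cabs ltcR cabs_distC.
Qed.

Lemma cvgCM (T : Type) (F : set_system T) (FF : Filter F)
    (f g : T -> C) (l m : C) :
  f @ F --> l -> g @ F --> m -> (fun x => f x * g x) @ F --> l * m.
Proof. exact: (@num_cvgM C). Qed.
Lemma cvgCD (T : Type) (F : set_system T) (FF : Filter F)
    (f g : T -> C) (l m : C) :
  f @ F --> l -> g @ F --> m -> (fun x => f x + g x) @ F --> l + m.
Proof. exact: (@num_cvgD C). Qed.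
Lemma cvgCV (T : Type) (F : set_system T) (FF : Filter F)
    (f : T -> C) (l : C) : l != 0 ->
  f @ F --> l -> (fun x => (f x)^-1) @ F --> l^-1.
Proof. exact: (@num_cvgV C). Qed.
Lemma cvgC_cst (T : Type) (F : set_system T) (FF : Filter F) (l : C) :
  (fun _ : T => l) @ F --> l.
Proof.
by apply/cvgC_cabsP => // e e0; apply: nearW => x; rewrite subrr cabs0.
Qed.
Lemma cvgCX (T : Type) (F : set_system T) (FF : Filter F)
    (f : T -> C) (l : C) n :
  f @ F --> l -> (fun x => f x ^+ n) @ F --> l ^+ n.
Proof.
move=> fl; elim: n => [|n IH]; first exact: cvgC_cst.
rewrite exprS; under eq_fun do rewrite exprS.
exact: cvgCM.
Qed.
Lemma cvgCB (T : Type) (F : set_system T) (FF : Filter F)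
    (f g : T -> C) (l m : C) :
  f @ F --> l -> g @ F --> m -> (fun x => f x - g x) @ F --> l - m.
Proof. exact: (@num_cvgB C). Qed.
Lemma cvgC_unique (T : Type) (F : set_system T) (FF : ProperFilter F)
    (f : T -> C) (l m : C) : f @ F --> l -> f @ F --> m -> l = m.
Proof. exact: (@num_cvg_unique C). Qed.

Lemma cvgC_cabs (T : Type) (F : set_system T) (FF : Filter F) (f : T -> C) (l : C) :
  f @ F --> l -> (fun x => cabs (f x)) @ F --> cabs l.
Proof.
move=> /(cvgC_cabsP FF) fl; apply/cvgrPdist_lt => e e0.
have := fl _ e0; apply: filterS => x; apply: le_lt_trans.
by rewrite ler_norml lerNl opprB cabs_lerB /= [leRHS]cabs_distC cabs_lerB.
Qed.

Lemma cvgC_real (T : Type) (F : set_system T) (FF : Filter F) (f : T -> R) (l : R) :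
  f @ F --> l -> (fun x => (f x)%:C) @ F --> l%:C.
Proof.
move=> /cvgrPdist_lt fl; apply/(cvgC_cabsP FF) => e e0.
have := fl _ e0; apply: filterS => x.
by rewrite -rmorphB cabs_real distrC.
Qed.

Lemma cvgC_pair (T : Type) (F : set_system T) (FF : Filter F) (f g : T -> R) (l m : R) :
  f @ F --> l -> g @ F --> m -> (fun x => f x +i* g x) @ F --> l +i* m.
Proof.
move=> fl gm.
have E (a b : R) : a +i* b = a%:C + 'i%C * b%:C by rewrite [LHS]complexE.
rewrite E; under eq_fun do rewrite E.
apply: cvgCD; first exact: cvgC_real.
by apply: cvgCM; [exact: cvgC_cst|exact: cvgC_real].
Qed.

Lemma cvgC_Re (T : Type) (F : set_system T) (FF : Filter F) (f : T -> C) (l : C) :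
  f @ F --> l -> (fun x => complex.Re (f x)) @ F --> complex.Re l.
Proof.
move=> /(cvgC_cabsP FF) fl; apply/cvgrPdist_lt => e e0.
have := fl _ e0; apply: filterS => x; apply: le_lt_trans.
by rewrite distrC -raddfB cabs_ge_Re.
Qed.
Lemma cvgC_Im (T : Type) (F : set_system T) (FF : Filter F) (f : T -> C) (l : C) :
  f @ F --> l -> (fun x => complex.Im (f x)) @ F --> complex.Im l.
Proof.
move=> /(cvgC_cabsP FF) fl; apply/cvgrPdist_lt => e e0.
have := fl _ e0; apply: filterS => x; apply: le_lt_trans.
by rewrite distrC -raddfB cabs_ge_Im.
Qed.

Lemma nbhsCP (z : C) (A : set C) :
  nbhs z A <-> exists2 d : R, 0 < d & forall w, cabs (w - z) < d -> A w.
Proof.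
split=> [/(num_nbhsP (K := C))[_ /gt0_complexP[r r0 ->] H]|[d d0 H]].
  by exists r => // w wr; apply: H; rewrite normr_cabs ltcR.
apply/(num_nbhsP (K := C)); exists d%:C; first by rewrite ltcR.
by move=> w; rewrite normr_cabs ltcR; exact: H.
Qed.

(** Linear approximation with error o(|w - z|): no division, [w = z] is allowed, and this is the
    form that the bisection of rectangles consumes. *)
Definition cderiv (f : C -> C) (z d : C) := forall e : R, 0 < e ->
  exists2 r : R, 0 < r &
    forall w, cabs (w - z) < r -> cabs (f w - f z - d * (w - z)) <= e * cabs (w - z).

Lemma derivableCP (f : C -> C) z :
  derivable f z 1 <-> exists d : C, cderiv f z d.
Proof.
split.
  move=> /(num_derivableP (K := C))[d H]; exists d => e e0.
  have e0' : 0 < e%:C by rewrite ltcR.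
  have [_ /gt0_complexP[r r0 ->] rP] := H _ e0'.
  exists r => // w wr; have := rP w.
  by rewrite !normr_cabs -rmorphM lecR ltcR; exact.
move=> [d H]; apply/(num_derivableP (K := C)); exists d.
move=> _ /gt0_complexP[e e0 ->]; have [r r0 rP] := H _ e0.
exists r%:C; first by rewrite ltcR.
by move=> w; rewrite !normr_cabs -rmorphM lecR ltcR; exact: rP.
Qed.

Lemma derivableCM (f g : C -> C) z : derivable f z 1 -> derivable g z 1 ->
  derivable (fun w => f w * g w) z 1.
Proof. exact: (@num_derivableM C). Qed.
Lemma derivableCV (f : C -> C) z : f z != 0 -> derivable f z 1 ->
  derivable (fun w => (f w)^-1) z 1.
Proof. exact: (@num_derivableV C). Qed.
Lemma derivableC_cst (c z : C) : derivable (fun=> c : C) z 1.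
Proof. exact: (@num_derivable_cst C). Qed.
Lemma derivableC_id (z : C) : derivable (fun w : C => w) z 1.
Proof. exact: (@num_derivable_id C). Qed.
Lemma derivableCX (f : C -> C) z n : derivable f z 1 ->
  derivable (fun w => f w ^+ n) z 1.
Proof.
move=> df; elim: n => [|n IH]; first exact: derivableC_cst.
by under eq_fun do rewrite exprS; exact: derivableCM.
Qed.
Lemma derivableCB (f g : C -> C) z : derivable f z 1 -> derivable g z 1 ->
  derivable (fun w => f w - g w) z 1.
Proof. exact: (@num_derivableB C). Qed.

Lemma cderiv_near (f g : C -> C) z d r : 0 < r ->
  (forall w, cabs (w - z) < r -> f w = g w) -> cderiv f z d -> cderiv g z d.
Proof.
move=> r0 fg H e e0; have [s s0 sP] := H _ e0.
exists (Num.min r s); first by rewrite lt_min r0.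
move=> w; rewrite lt_min => /andP[wr ws].
by rewrite -!fg ?subrr ?cabs0//; exact: sP.
Qed.

Lemma derivableC_near (f g : C -> C) z r : 0 < r ->
  (forall w, cabs (w - z) < r -> f w = g w) -> derivable f z 1 -> derivable g z 1.
Proof.
move=> r0 fg /derivableCP[d H]; apply/derivableCP; exists d.
exact: cderiv_near fg H.
Qed.

Lemma derivableC_shift (f : C -> C) z b : derivable f (z + b) 1 ->
  derivable (fun w => f (w + b)) z 1.
Proof.
move=> /derivableCP[d H]; apply/derivableCP; exists d => e e0.
have [r r0 rP] := H _ e0; exists r => // w wr.
have E : w - z = w + b - (z + b) by rewrite opprD addrACA subrr addr0.
by rewrite E; apply: rP; rewrite -E.
Qed.

Lemma derivableC_continuous (f : C -> C) z : derivable f z 1 -> f @ z --> f z.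
Proof.
move=> /derivableCP[d H]; apply/(@cvgC_cabsP _ (nbhs z) _ f) => e e0.
have [r r0 rP] := H 1 ltr01.
have D0 : 0 < 1 + cabs d by rewrite ltr_pwDl// cabs_ge0.
apply/nbhsCP; exists (Num.min r (e / (1 + cabs d))).
  by rewrite lt_min r0 divr_gt0.
move=> w; rewrite lt_min => /andP[/rP {}rP]; rewrite ltr_pdivlMr// => wr.
apply: le_lt_trans wr; rewrite mulrDr mulr1.
have -> : f w - f z = (f w - f z - d * (w - z)) + d * (w - z) by rewrite subrK.
apply: (le_trans (cabsD_le _ _)); rewrite lerD//; last by rewrite cabsM mulrC.
by rewrite (le_trans rP)// mul1r.
Qed.

End ComplexNorm.

(** * Complex-valued integrals on segments *)

(** The segment carries no orientation: for [b < a] the integral is 0 and not the opposite of the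
    integral from [b] to [a], so the lemmas below keep track of the order of the endpoints where it
    matters. *)
HB.lock Definition cint (R : realType) (a b : R) (f : R -> R[i]) : R[i] :=
  (\int[@lebesgue_measure R]_(t in `[a, b]) complex.Re (f t))%R +i*
  (\int[@lebesgue_measure R]_(t in `[a, b]) complex.Im (f t))%R.

Section Integral.
Variable R : realType.
Local Notation C := R[i].
Local Notation mu := (@lebesgue_measure R).

Definition cont_on (a b : R) (f : R -> C) :=
  forall t : R, a <= t <= b -> f @ t --> f t.

Lemma continuous_integrable a b (f : R -> R) :
  (forall t : R, a <= t <= b -> f @ t --> f t) ->
  mu.-integrable `[a, b] (EFin \o f).
Proof.
move=> cf; apply: continuous_compact_integrable; first exact: segment_compact.
apply: continuous_in_subspaceT => t /set_mem /=.
by rewrite in_itv /=; exact: cf.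
Qed.

Lemma cont_on_Re a b f : cont_on a b f ->
  mu.-integrable `[a, b] (EFin \o (fun t => complex.Re (f t))).
Proof. by move=> cf; apply: continuous_integrable => t /cf; exact: cvgC_Re. Qed.
Lemma cont_on_Im a b f : cont_on a b f ->
  mu.-integrable `[a, b] (EFin \o (fun t => complex.Im (f t))).
Proof. by move=> cf; apply: continuous_integrable => t /cf; exact: cvgC_Im. Qed.

Lemma eq_cint a b f g : (forall t : R, a <= t <= b -> f t = g t) ->
  cint a b f = cint a b g.
Proof.
move=> fg; rewrite cint.unlock; congr (_ +i* _); apply: eq_Rintegral => t;
  by rewrite inE /= in_itv /= => /fg ->.
Qed.

Lemma cintD a b f g : cont_on a b f -> cont_on a b g ->
  cint a b (fun t => f t + g t) = cint a b f + cint a b g.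
Proof.
move=> cf cg; rewrite cint.unlock; apply/eqP; rewrite eq_complex /=; apply/andP; split.
  rewrite -RintegralD//; [|exact: cont_on_Re|exact: cont_on_Re].
  by apply/eqP/eq_Rintegral => t _; rewrite raddfD.
rewrite -RintegralD//; [|exact: cont_on_Im|exact: cont_on_Im].
by apply/eqP/eq_Rintegral => t _; rewrite raddfD.
Qed.

Lemma integrable_scale a b (c : R) (f : R -> R) :
  mu.-integrable `[a, b] (EFin \o f) ->
  mu.-integrable `[a, b] (EFin \o (fun t => c * f t)).
Proof.
move=> fi.
have mab : measurable (`[a, b]%classic : set R) by exact: measurable_itv.
exact: (@integrableZl _ _ R mu _ mab c _ fi).
Qed.

Lemma cintZ a b (c : C) f : cont_on a b f ->
  cint a b (fun t => c * f t) = c * cint a b f.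
Proof.
case: c => x y cf; rewrite cint.unlock.
have iR := cont_on_Re cf; have iI := cont_on_Im cf.
apply/eqP; rewrite eq_complex /=; apply/andP; split; apply/eqP.
  rewrite -!RintegralZl// -RintegralB//; try exact: integrable_scale.
  by apply: eq_Rintegral => t _; case: (f t).
rewrite -!RintegralZl// -RintegralD//; try exact: integrable_scale.
by apply: eq_Rintegral => t _; case: (f t) => u v /=.
Qed.

Lemma cont_onZ a b (c : C) f : cont_on a b f -> cont_on a b (fun t => c * f t).
Proof. by move=> cf t /cf; apply: cvgCM; exact: cvgC_cst. Qed.
Lemma cont_onM a b f g : cont_on a b f -> cont_on a b g ->
  cont_on a b (fun t => f t * g t).
Proof. by move=> cf cg t tab; apply: cvgCM; [exact: cf|exact: cg]. Qed.
Lemma cont_onD a b f g : cont_on a b f -> cont_on a b g ->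
  cont_on a b (fun t => f t + g t).
Proof. by move=> cf cg t tab; apply: cvgCD; [exact: cf|exact: cg]. Qed.
Lemma cont_onB a b f g : cont_on a b f -> cont_on a b g ->
  cont_on a b (fun t => f t - g t).
Proof. by move=> cf cg t tab; apply: cvgCB; [exact: cf|exact: cg]. Qed.
Lemma cont_on_cst a b (c : C) : cont_on a b (fun=> c).
Proof. by move=> t _; exact: cvgC_cst. Qed.

Lemma cintB a b f g : cont_on a b f -> cont_on a b g ->
  cint a b (fun t => f t - g t) = cint a b f - cint a b g.
Proof.
move=> cf cg; have E (x y : C) : x - y = x + (-1) * y by rewrite mulN1r.
rewrite E -(cintZ _ cg) -(cintD cf (cont_onZ (c := -1) cg)).
by apply: eq_cint => t _; exact: E.
Qed.

Lemma cint_sum a b (I : Type) (s : seq I) (F : I -> R -> C) :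
  (forall i, cont_on a b (F i)) ->
  cint a b (fun t => \sum_(i <- s) F i t) = \sum_(i <- s) cint a b (F i).
Proof.
move=> cF; have cS l : cont_on a b (fun t => \sum_(i <- l) F i t).
  elim: l => [|i l IH].
    have -> : (fun t => \sum_(i <- [::]) F i t) = fun=> 0.
      by apply/funext => t; rewrite big_nil.
    exact: cont_on_cst.
  have -> : (fun t => \sum_(j <- i :: l) F j t) =
      fun t => F i t + \sum_(j <- l) F j t.
    by apply/funext => t; rewrite big_cons.
  exact: (cont_onD (cF i) IH).
elim: s => [|i s IH].
  rewrite big_nil (@eq_cint _ _ _ (fun t => 0 * 0)).
    by rewrite (cintZ _ (@cont_on_cst a b 0)) mul0r.
  by move=> t _; rewrite big_nil mul0r.
rewrite big_cons -IH -(cintD (cF i) (cS s)).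
by apply: eq_cint => t _; rewrite big_cons.
Qed.

Lemma Rint_split a b c (f : R -> R) : a <= b <= c ->
  mu.-integrable `[a, c] (EFin \o f) ->
  \int[mu]_(t in `[a, c]) f t =
  \int[mu]_(t in `[a, b]) f t + \int[mu]_(t in `[b, c]) f t.
Proof.
move=> /andP[ab bc] fi.
have := @Rintegral_itvB R f (BLeft a) (BRight c) b fi.
rewrite !bnd_simp => /(_ ab bc).
rewrite Rintegral_itv_obnd_cbnd; first by move=> <-; rewrite addrC subrK.
apply: integrableS fi => //; apply: subset_itvr.
by rewrite bnd_simp.
Qed.

Lemma cint_split a b c f : a <= b <= c -> cont_on a c f ->
  cint a c f = cint a b f + cint b c f.
Proof.
move=> abc cf; rewrite cint.unlock.
rewrite (Rint_split abc (cont_on_Re cf)) (Rint_split abc (cont_on_Im cf)).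
by [].
Qed.

Lemma cint_norm a b f : cont_on a b f ->
  cabs (cint a b f) <= 2 * \int[mu]_(t in `[a, b]) cabs (f t).
Proof.
move=> cf; apply: (le_trans (cabs_le_ReIm _)) => /=; rewrite mulr_natl mulr2n.
have iN : mu.-integrable `[a, b] (EFin \o (fun t => cabs (f t))).
  by apply: continuous_integrable => t /cf; exact: cvgC_cabs.
have iabs (g : R -> R) : mu.-integrable `[a, b] (EFin \o g) ->
    mu.-integrable `[a, b] (EFin \o (fun t => `|g t|)).
  by exact: integrable_norm.
have mab : measurable (`[a, b]%classic : set R) by exact: measurable_itv.
rewrite cint.unlock; apply: lerD => /=.
  apply: (le_trans (@le_normr_Rintegral _ _ R mu _ _ mab (cont_on_Re cf))).
  apply: (@le_Rintegral _ _ R mu _ _ _ mab _ iN); first exact/iabs/cont_on_Re.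
  by move=> t _; exact: cabs_ge_Re.
apply: (le_trans (@le_normr_Rintegral _ _ R mu _ _ mab (cont_on_Im cf))).
apply: (@le_Rintegral _ _ R mu _ _ _ mab _ iN); first exact/iabs/cont_on_Im.
by move=> t _; exact: cabs_ge_Im.
Qed.

Lemma fine_mu_itv (a b : R) : a <= b -> fine (mu `[a, b]) = b - a.
Proof.
move=> ab; rewrite lebesgue_measure_itv /= lte_fin.
by case: ltgtP ab => //= -> _; rewrite subrr.
Qed.

Lemma cint_bound a b f M : a <= b -> cont_on a b f ->
  (forall t, a <= t <= b -> cabs (f t) <= M) ->
  cabs (cint a b f) <= 2 * (M * (b - a)).
Proof.
move=> ab cf fM; apply: (le_trans (cint_norm cf)).
rewrite ler_pM2l// -fine_mu_itv//.
have mab : measurable (`[a, b]%classic : set R) by exact: measurable_itv.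
rewrite -(@Rintegral_cst _ _ R mu _ mab); apply: (@le_Rintegral _ _ R mu _ _ _ mab).
- by apply: continuous_integrable => t /cf; exact: cvgC_cabs.
- by apply: continuous_integrable => t _; exact: cvg_cst.
- by move=> t; rewrite /= in_itv /=; exact: fM.
Qed.

Lemma cint_cst a b (c : C) : a <= b -> cint a b (fun=> c) = c * (b - a)%:C.
Proof.
move=> ab; rewrite cint.unlock.
have mab : measurable (`[a, b]%classic : set R) by exact: measurable_itv.
have E (x : R) : \int[mu]_(t in `[a, b]) x = x * (b - a).
  by rewrite -fine_mu_itv//; exact: (@Rintegral_cst _ _ R mu _ mab).
by rewrite !E; case: c => x y; apply/eqP; rewrite eq_complex /= !mulr0 subr0 add0r !eqxx.
Qed.

Definition cis (t : R) : C := cos t +i* sin t.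

Lemma cabs_cis t : cabs (cis t) = 1.
Proof. by rewrite cabs.unlock /= cos2Dsin2 sqrtr1. Qed.
Lemma cis_neq0 t : cis t != 0. Proof. by rewrite -cabs_gt0 cabs_cis. Qed.
Lemma cis0 : cis 0 = 1. Proof. by rewrite /cis cos0 sin0. Qed.
Lemma cis2pi : cis (2 * pi) = 1.
Proof. by rewrite /cis mulr_natl cos2pi sin2pi. Qed.
Lemma cisD s t : cis (s + t) = cis s * cis t.
Proof.
by rewrite /cis cosD sinD; apply/eqP; rewrite eq_complex /= eqxx /=; apply/eqP; ring.
Qed.
Lemma cisX n t : cis (n%:R * t) = cis t ^+ n.
Proof.
elim: n => [|n IH]; first by rewrite mul0r cis0.
by rewrite exprS -IH -cisD -natr1 mulrDl mul1r addrC.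
Qed.
Lemma cisN t : cis (- t) = (cis t)^-1.
Proof.
apply: (mulfI (cis_neq0 t)); rewrite mulfV ?cis_neq0//.
by rewrite -cisD subrr cis0.
Qed.
Lemma continuous_cis (t : R) : cis @ t --> cis t.
Proof. by apply: cvgC_pair; [exact: continuous_cos|exact: continuous_sin]. Qed.
Lemma cont_on_cis a b : cont_on a b cis.
Proof. by move=> t _; exact: continuous_cis. Qed.

Lemma Rint_FTC a b (f F : R -> R) : a <= b ->
  (forall t, f @ t --> f t) -> (forall t : R, is_derive t (1 : R) F (f t)) ->
  \int[mu]_(t in `[a, b]) f t = F b - F a.
Proof.
rewrite le_eqVlt => /predU1P[<- _ _|ab cf dF].
  by rewrite set_itv1 Rintegral_set1 subrr.
have cF : continuous F.
  move=> t; apply: differentiable_continuous; apply/derivable1_diffP.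
  by have := dF t => -[].
rewrite /Rintegral (@continuous_FTC2 _ _ F)//.
- by apply: continuous_subspaceT.
- split.
  + by move=> x _; have := dF x => -[].
  + by apply: cvg_at_right_filter; exact: cF.
  + by apply: cvg_at_left_filter; exact: cF.
- by move=> x _; rewrite derive1E; have := dF x => -[].
Qed.

Lemma cint_dcis a b : a <= b -> cint a b (fun t => 'i%C * cis t) = cis b - cis a.
Proof.
move=> ab; rewrite (eq_cint (g := fun t => (- sin t) +i* cos t)); last first.
  by move=> t _; rewrite /cis; apply/eqP;
    rewrite eq_complex /= !mul0r !mul1r sub0r add0r !eqxx.
rewrite cint.unlock /=.
rewrite (Rint_FTC ab _ (fun t => is_derive_cos t)); last first.
  by move=> t; apply: cvgN; exact: continuous_sin.
rewrite (Rint_FTC ab _ (fun t => is_derive_sin t)); last first.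
  by move=> t; exact: continuous_cos.
by apply/eqP; rewrite eq_complex /= !eqxx.
Qed.

Lemma is_derive_mull (f : R -> R) (k x d : R) :
  is_derive x 1 f d -> is_derive x 1 (fun y => k * f y) (k * d).
Proof. exact: is_deriveZ. Qed.

Lemma is_derive_opp (f : R -> R) (x d : R) :
  is_derive x 1 f d -> is_derive x 1 (fun y => - f y) (- d).
Proof. exact: is_deriveN. Qed.

Lemma cint_cisX (n : nat) : cint 0 (2 * pi) (fun t => (cis t)^-1 ^+ n.+1) = 0.
Proof.
have n0 : - n.+1%:R != 0 :> R by rewrite oppr_eq0 pnatr_eq0.
set k : R := - n.+1%:R in n0.
have dk (t : R) : is_derive t (1 : R) (fun x => k * x) k.
  by have := is_derive_mull k (is_derive_id t (1 : R)); rewrite mulr1.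
have dsin (t : R) : is_derive t (1 : R) (fun x => k^-1 * sin (k * x)) (cos (k * t)).
  have := is_derive_mull k^-1 (is_derive1_comp (is_derive_sin (k * t)) (dk t)).
  by rewrite [_ * k]mulrC mulKf.
have dcos (t : R) : is_derive t (1 : R) (fun x => - (k^-1 * cos (k * x))) (sin (k * t)).
  have := is_derive_opp (is_derive_mull k^-1
    (is_derive1_comp (is_derive_cos (k * t)) (dk t))).
  by rewrite [_ * k]mulrC mulKf// opprK.
have E t : (cis t)^-1 ^+ n.+1 = cis (k * t).
  by rewrite exprVn -cisX -cisN mulNr.
have ck (t : R) : (fun x => k * x) @ t --> k * t.
  by apply: cvgM; [exact: cvg_cst|exact: cvg_id].
have [c1 s1] : cos (k * (2 * pi)) = 1 /\ sin (k * (2 * pi)) = 0.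
  have : cis (k * (2 * pi)) = 1.
    by rewrite -E cis2pi invr1 expr1n.
  by rewrite /cis => -[].
rewrite (eq_cint (g := fun t => cis (k * t))); last by move=> t _; exact: E.
rewrite cint.unlock /=.
have pi0 : 0 <= 2 * pi :> R by rewrite mulr_ge0// pi_ge0.
rewrite (Rint_FTC pi0 _ dsin); last first.
  by move=> t; apply: (continuous_comp (ck t)); exact: continuous_cos.
rewrite (Rint_FTC pi0 _ dcos); last first.
  by move=> t; apply: (continuous_comp (ck t)); exact: continuous_sin.
by rewrite c1 s1 !mulr0 cos0 sin0 !mulr0 !subrr.
Qed.

End Integral.

(** * Bisection of rectangles *)

Lemma nested_itv (R : realType) (x y : nat -> R) :
  (forall n, x n <= x n.+1) -> (forall n, y n.+1 <= y n) ->
  (forall n, x n <= y n) -> exists p, forall n, x n <= p <= y n.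
Proof.
move=> xS yS xy.
have xm n m : (n <= m)%N -> x n <= x m.
  by move=> /subnK <-; elim: (m - n)%N => // k IH; rewrite addSn (le_trans IH).
have ym n m : (n <= m)%N -> y m <= y n.
  by move=> /subnK <-; elim: (m - n)%N => // k IH; rewrite addSn (le_trans _ IH).
have xyl n m : x n <= y m.
  apply: (le_trans (xm _ _ (leq_maxl n m))).
  by apply: (le_trans (xy _)); exact: ym (leq_maxr n m).
exists (sup (range x)) => n; apply/andP; split.
  apply: ub_le_sup; last by exists n.
  by exists (y 0) => _ [k _ <-].
by apply: sup_le_ub; [exists (x 0%N), 0%N|move=> _ [k _ <-]].
Qed.

Lemma halfE (R : realType) n (x : R) : (x / 2 ^+ n) / 2 = x / 2 ^+ n.+1.
Proof. by rewrite exprSr invfM mulrA mulrC mulrCA mulrA. Qed.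

Lemma exp2_gt (R : realType) n : (n%:R : R) < 2 ^+ n.
Proof. by rewrite -natrX ltr_nat ltn_expl. Qed.

Section Bisection.
Variable R : realType.
Local Notation C := R[i].
Variables (J : R -> R -> R -> R -> C) (a b c d : R).
Hypotheses (ab : a <= b) (cd : c <= d).
Hypothesis J_splitl : forall s1 s2 s3 t1 t2,
  a <= s1 -> s1 <= s2 -> s2 <= s3 -> s3 <= b -> c <= t1 -> t1 <= t2 -> t2 <= d ->
  J s1 s3 t1 t2 = J s1 s2 t1 t2 + J s2 s3 t1 t2.
Hypothesis J_splitr : forall s1 s2 t1 t2 t3,
  a <= s1 -> s1 <= s2 -> s2 <= b -> c <= t1 -> t1 <= t2 -> t2 <= t3 -> t3 <= d ->
  J s1 s2 t1 t3 = J s1 s2 t1 t2 + J s1 s2 t2 t3.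
Hypothesis J_local : forall s0 t0 e, a <= s0 <= b -> c <= t0 <= d -> 0 < e ->
  exists2 r, 0 < r & forall s1 s2 t1 t2,
    a <= s1 -> s1 <= s0 <= s2 -> s2 <= b -> c <= t1 -> t1 <= t0 <= t2 -> t2 <= d ->
    (s2 - s1) + (t2 - t1) < r ->
    cabs (J s1 s2 t1 t2) <= e * ((s2 - s1) + (t2 - t1)) ^+ 2.

Let good (q : (R * R) * (R * R)) :=
  [/\ a <= q.1.1, q.1.1 <= q.1.2, q.1.2 <= b & [/\ c <= q.2.1, q.2.1 <= q.2.2 & q.2.2 <= d]].

Let half (q q' : (R * R) * (R * R)) :=
  [/\ good q', [/\ q.1.1 <= q'.1.1, q'.1.2 <= q.1.2, q.2.1 <= q'.2.1 & q'.2.2 <= q.2.2],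
   q'.1.2 - q'.1.1 = (q.1.2 - q.1.1) / 2, q'.2.2 - q'.2.1 = (q.2.2 - q.2.1) / 2 &
   cabs (J q.1.1 q.1.2 q.2.1 q.2.2) <= 4 * cabs (J q'.1.1 q'.1.2 q'.2.1 q'.2.2)].

Let bisect q : good q -> exists q', half q q'.
Proof.
case: q => [[s1 s2] [t1 t2]] [/= as1 s12 s2b [ct1 t12 t2d]].
pose s := (s1 + s2) / 2; pose t := (t1 + t2) / 2.
have [ss1 ss2] : s1 <= s /\ s <= s2 by split; rewrite /s; lra.
have [tt1 tt2] : t1 <= t /\ t <= t2 by split; rewrite /t; lra.
have E : J s1 s2 t1 t2 =
    (J s1 s t1 t + J s1 s t t2) + (J s s2 t1 t + J s s2 t t2).
  have le := le_trans.
  rewrite (@J_splitl s1 s s2)// (@J_splitr s1 s t1 t)//; last exact: le s2b.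
  by rewrite (@J_splitr s s2 t1 t)//; exact: le ss1.
have /orP H : (cabs (J s1 s2 t1 t2) <= 4 * cabs (J s1 s t1 t)) ||
   [|| cabs (J s1 s2 t1 t2) <= 4 * cabs (J s1 s t t2),
       cabs (J s1 s2 t1 t2) <= 4 * cabs (J s s2 t1 t) |
       cabs (J s1 s2 t1 t2) <= 4 * cabs (J s s2 t t2)].
  have : cabs (J s1 s2 t1 t2) <= cabs (J s1 s t1 t) + cabs (J s1 s t t2) +
      (cabs (J s s2 t1 t) + cabs (J s s2 t t2)).
    rewrite E; apply: (le_trans (cabsD_le _ _)).
    by apply: lerD; exact: cabsD_le.
  do 4!case: leP => //=; lra.
have sE1 : s - s1 = (s2 - s1) / 2 by rewrite /s; lra.
have sE2 : s2 - s = (s2 - s1) / 2 by rewrite /s; lra.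
have tE1 : t - t1 = (t2 - t1) / 2 by rewrite /t; lra.
have tE2 : t2 - t = (t2 - t1) / 2 by rewrite /t; lra.
case: H => [H|/or3P[H|H|H]];
  [exists ((s1, s), (t1, t))|exists ((s1, s), (t, t2))|
   exists ((s, s2), (t1, t))|exists ((s, s2), (t, t2))];
  by split => //; split => //=; (try split => //);
    do ?[exact: le_trans as1 _|exact: le_trans ct1 _|exact: le_trans _ s2b|
         exact: le_trans _ t2d].
Qed.

(** Goursat's argument for an abstract additive function of rectangles. After [n] bisections some
    rectangle of size [L / 2 ^+ n] still carries at least the fraction [1 / 4 ^+ n] of the modulus
    of [J], whereas near the common point of these rectangles [J] is o(size^2). *)
Lemma rect_bisection : J a b c d = 0.
Proof.
have [F FP] : exists F, forall q, good q -> half q (F q).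
  have /choice[F FP] : forall q, exists q', good q -> half q q'.
    move=> q; have [gq|gq] := pselect (good q); last by exists q.
    by have [q' hq] := bisect gq; exists q'.
  by exists F.
pose q n := iter n F ((a, b), (c, d)).
have gq n : good (q n).
  elim: n => [|n IH]; first by do 2?split => /=.
  by rewrite /q iterS; have [] := FP _ IH.
have hq n : half (q n) (q n.+1) by exact: FP.
have [s0 s0P] : exists p, forall n, (q n).1.1 <= p <= (q n).1.2.
  by apply: nested_itv => n; have [_ [? ? ? ?] _ _ _] := hq n => //; have [] := gq n.
have [t0 t0P] : exists p, forall n, (q n).2.1 <= p <= (q n).2.2.
  by apply: nested_itv => n; have [_ [? ? ? ?] _ _ _] := hq n => //; have [_ _ _ []] := gq n.
pose w n := ((q n).1.2 - (q n).1.1) + ((q n).2.2 - (q n).2.1).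
pose L := (b - a) + (d - c).
have wE n : w n = L / 2 ^+ n.
  elim: n => [|n IH]; first by rewrite expr0 divr1.
  rewrite -halfE -IH /w; have [_ _ -> ->] := hq n; rewrite -mulrDl.
  by [].
have L0 : 0 <= L by rewrite /L addr_ge0// subr_ge0.
pose Jq n := cabs (J (q n).1.1 (q n).1.2 (q n).2.1 (q n).2.2).
have Jn n : Jq 0%N <= 4 ^+ n * Jq n.
  elim: n => [|n IH]; first by rewrite expr0 mul1r.
  apply: (le_trans IH); rewrite exprSr -mulrA ler_pM2l ?exprn_gt0//.
  by have [_ _ _ _] := hq n.
apply/eqP; rewrite -cabs_eq0 eq_le cabs_ge0 andbT; apply/ler_addgt0Pl => e e0.
rewrite addr0.
(* [L] is 0 when the rectangle is a point; [L + 1] is always a valid denominator. *)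
pose e' := e / (L + 1) ^+ 2.
have L1 : 0 < (L + 1) ^+ 2 by rewrite exprn_gt0// ltr_wpDl.
have e'0 : 0 < e' by rewrite divr_gt0.
have s0ab : a <= s0 <= b by exact: (s0P 0%N).
have t0cd : c <= t0 <= d by exact: (t0P 0%N).
have [r r0 rP] := J_local s0ab t0cd e'0.
pose n := (Num.truncn (L / r)).+1.
have wn : w n < r.
  rewrite wE ltr_pdivrMr ?exprn_gt0// mulrC -ltr_pdivrMr//.
  by apply: lt_trans (exp2_gt _ n); exact: truncnS_gt.
have [g1 g2 g3 [g4 g5 g6]] := gq n.
have := rP _ _ _ _ g1 (s0P n) g3 g4 (t0P n) g6 wn.
rewrite -/(w n) -/(Jq n) => H.
apply: (le_trans (Jn n)).
apply: (@le_trans _ _ (4 ^+ n * (e' * w n ^+ 2))).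
  by rewrite ler_pM2l ?exprn_gt0.
have -> : 4 ^+ n * (e' * w n ^+ 2) = e' * L ^+ 2.
  rewrite wE exprMn exprVn -exprM mulnC exprM.
  have -> : (2 ^+ 2 : R) = 4 by rewrite -natrX.
  by rewrite mulrCA [_ * _^-1]mulrC mulVKf// expf_neq0.
rewrite /e' mulrAC ler_pdivrMr// ler_pM2l// lerXn2r ?nnegrE// ?lerDl//.
by rewrite addr_ge0.
Qed.

End Bisection.

(** * Cauchy's formula on circles *)

(** The chord is the integral of the derivative of [cis] along the arc; the 2 is inherited from
    [cint_bound]. *)
Lemma cis_lip (R : realType) (s t : R) : cabs (cis s - cis t) <= 2 * `|s - t|.
Proof.
wlog st : s t / t <= s.
  move=> H; have [/H//|/ltW/H] := leP t s.
  by rewrite cabs_distC distrC.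
rewrite -(cint_dcis st) ger0_norm ?subr_ge0//.
rewrite -[s - t]mul1r; apply: cint_bound => //.
  by apply: cont_onZ; exact: cont_on_cis.
by move=> u _; rewrite cabsM cabs_cis mulr1 cabs_i.
Qed.

(** Used whenever an estimate holds at every order [n]: remainders of expansions, and powers of a
    function that absorb a constant factor. *)
Lemma exp_arbitrarily_small (R : realType) (q M y : R) : 0 <= q < 1 ->
  (forall n, y <= M * q ^+ n) -> y <= 0.
Proof.
move=> /andP[q0 q1] H.
have cv : (fun n => M * q ^+ n) @ \oo --> M * 0.
  apply: cvgM; first exact: cvg_cst.
  by apply: cvg_expr; rewrite ger0_norm.
rewrite mulr0 in cv.
have <- : limn (fun n => M * q ^+ n) = 0 by exact: cvg_lim cv.
apply: limr_ge; first by apply/cvg_ex; exists 0.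
by apply: nearW.
Qed.

Section Cauchy.
Variable R : realType.
Local Notation C := R[i].
Variables (f : C -> C) (rho r : R) (a : C).
Hypothesis df : forall z, cabs z < rho -> derivable f z 1.
Hypotheses (r_rho : r < rho) (ar : cabs a < r).

Let r0 : 0 < r. Proof. exact: le_lt_trans (cabs_ge0 a) ar. Qed.
(** [z] contracts the circle ([s = 1]) to the point [a] ([s = 0]) along segments. As z - a = s e(t)
    and e'(t) = i x(t), the form dz/(z - a) reads ds/s + kappa(t) dt in these coordinates; [A] and
    [B] below integrate its two parts against [f], and [K] bounds [kappa]. *)
Let x (t : R) : C := r%:C * cis t.
Let e (t : R) : C := x t - a.
Let kappa (t : R) : C := 'i%C * (x t / e t).
Let z (s t : R) : C := a + s%:C * e t.
Let K := r / (r - cabs a).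

Let Nx t : cabs (x t) = r.
Proof. by rewrite cabsM cabs_cis mulr1 cabs_real gtr0_norm. Qed.
Let x0 t : x t != 0. Proof. by rewrite -cabs_gt0 Nx. Qed.
Let Ne_ge t : r - cabs a <= cabs (e t).
Proof. by rewrite -(Nx t) cabs_lerB. Qed.
Let ra0 : 0 < r - cabs a. Proof. by rewrite subr_gt0. Qed.
Let e0 t : e t != 0.
Proof. by rewrite -cabs_gt0; exact: lt_le_trans ra0 (Ne_ge t). Qed.
Let Ne_le t : cabs (e t) <= 2 * r.
Proof. by apply: (le_trans (cabsB_le _ _)); rewrite Nx mulr_natl mulr2n lerD2l ltW. Qed.
Let K0 : 0 < K. Proof. by rewrite divr_gt0. Qed.
Let Nxe t : cabs (x t / e t) <= K.
Proof.
rewrite cabsM cabsV Nx ler_pM2l// lef_pV2 ?posrE//.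
by rewrite cabs_gt0.
Qed.
Let Nk t : cabs (kappa t) <= K.
Proof. by rewrite cabsM cabs_i mul1r. Qed.

Let cx (t : R) : x @ t --> x t.
Proof. by apply: cvgCM; [exact: cvgC_cst|exact: continuous_cis]. Qed.
Let ce (t : R) : e @ t --> e t.
Proof. by apply: cvgCB; [exact: cx|exact: cvgC_cst]. Qed.
Let cxe (t : R) : (fun t => x t / e t) @ t --> x t / e t.
Proof. by apply: cvgCM; [exact: cx|apply: cvgCV; [exact: e0|exact: ce]]. Qed.
Let ck (t : R) : kappa @ t --> kappa t.
Proof. by apply: cvgCM; [exact: cvgC_cst|exact: cxe]. Qed.

Let Nz s t : 0 <= s <= 1 -> cabs (z s t) < rho.
Proof.
move=> /andP[s0 s1]; apply: le_lt_trans r_rho.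
have -> : z s t = (1 - s)%:C * a + s%:C * x t.
  by rewrite /z /e rmorphB rmorph1; ring.
apply: (le_trans (cabsD_le _ _)); rewrite (cabsM (1 - s)%:C) (cabsM s%:C) !cabs_real Nx.
rewrite !ger0_norm ?subr_ge0//.
have : (1 - s) * cabs a <= (1 - s) * r by rewrite ler_wpM2l ?subr_ge0// ltW.
lra.
Qed.

Let cf s t : 0 <= s <= 1 -> f @ z s t --> f (z s t).
Proof. by move=> s01; apply: derivableC_continuous; apply: df; exact: Nz. Qed.

Let cz_t (s t : R) : z s @ t --> z s t.
Proof.
by apply: cvgCD; [exact: cvgC_cst|apply: cvgCM; [exact: cvgC_cst|exact: ce]].
Qed.
Let cz_s (s t : R) : z^~ t @ s --> z s t.
Proof.
apply: cvgCD; [exact: cvgC_cst|apply: cvgCM; [|exact: cvgC_cst]].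
by apply: cvgC_real; exact: cvg_id.
Qed.

Let cfz_t (s t : R) : 0 <= s <= 1 -> (fun t => f (z s t)) @ t --> f (z s t).
Proof. by move=> s01; apply: cvg_comp (@cz_t s t) _; exact: cf. Qed.
Let cfz_s (s t : R) : 0 <= s <= 1 -> (fun s => f (z s t)) @ s --> f (z s t).
Proof. by move=> s01; apply: cvg_comp (@cz_s s t) _; exact: cf. Qed.

Let A s t1 t2 := cint t1 t2 (fun t => f (z s t) * kappa t).
Let B t s1 s2 := cint s1 s2 (fun s => f (z s t) * (s%:C)^-1).

Let contA s t1 t2 : 0 <= s <= 1 ->
  cont_on t1 t2 (fun t => f (z s t) * kappa t).
Proof. by move=> s01 t _; apply: cvgCM; [exact: cfz_t|exact: ck]. Qed.

Let contV s1 s2 : 0 < s1 -> cont_on s1 s2 (fun s => (s%:C)^-1 : C).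
Proof.
move=> s10 s /andP[s1s _]; apply: cvgCV; last by apply: cvgC_real; exact: cvg_id.
by rewrite -cabs_gt0 cabs_real normr_gt0 gt_eqF// (lt_le_trans s10).
Qed.

Let contB t s1 s2 : 0 < s1 -> s2 <= 1 ->
  cont_on s1 s2 (fun s => f (z s t) * (s%:C)^-1).
Proof.
move=> s10 s21 s s12; apply: cvgCM; last exact: (contV s10 s12).
apply: cfz_s; case/andP: s12 => s1s s2s.
by rewrite (le_trans (ltW s10))//= (le_trans s2s).
Qed.

(* The integral of the closed form [f(z) dz/(z - a)] along the boundary of the
   image of the rectangle [[s1, s2] x [t1, t2]]. *)
Let J s1 s2 t1 t2 := A s2 t1 t2 - A s1 t1 t2 - B t2 s1 s2 + B t1 s1 s2.

Let cint_x t1 t2 : t1 <= t2 -> cint t1 t2 (fun t => 'i%C * x t) = e t2 - e t1.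
Proof.
move=> t12; rewrite (@eq_cint _ _ _ _ (fun t => r%:C * ('i%C * cis t))); last first.
  by move=> t _; rewrite /x mulrCA.
rewrite cintZ; last by apply: cont_onZ; exact: cont_on_cis.
by rewrite (cint_dcis t12) /e /x; ring.
Qed.

Section Local.
Variables (c D : C) (eta : R) (s1 s2 t1 t2 del : R).
Hypotheses (del0 : 0 < del) (ds1 : del <= s1) (s12 : s1 <= s2) (s21 : s2 <= 1).
Hypothesis t12 : t1 <= t2.
Hypothesis close : forall s t, s1 <= s <= s2 -> t1 <= t <= t2 ->
  cabs (f (z s t) - (c + D * (s%:C * e t))) <= eta.

Let s10 : 0 < s1. Proof. exact: lt_le_trans ds1. Qed.

Let A_aff s : s1 <= s <= s2 ->
  cabs (A s t1 t2 - (c * cint t1 t2 kappa + D * s%:C * (e t2 - e t1)))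
    <= 2 * (eta * K * (t2 - t1)).
Proof.
move=> s12'; have s01 : 0 <= s <= 1.
  case/andP: s12' => s1s ss2.
  by rewrite (le_trans (ltW s10))//= (le_trans ss2).
have ck' : cont_on t1 t2 kappa by move=> t _; exact: ck.
have cix : cont_on t1 t2 (fun t => 'i%C * x t).
  by move=> t _; apply: cvgCM; [exact: cvgC_cst|exact: cx].
rewrite -(cint_x t12) -(cintZ c ck') -(cintZ (D * s%:C) cix).
rewrite -(cintD (cont_onZ (c := c) ck') (cont_onZ (c := D * s%:C) cix)).
have cA := @contA s t1 t2 s01.
have caff : cont_on t1 t2 (fun t => c * kappa t + D * s%:C * ('i%C * x t)).
  exact: (cont_onD (cont_onZ (c := c) ck') (cont_onZ (c := D * s%:C) cix)).
rewrite -(cintB cA caff).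
apply: (cint_bound t12); first exact: (cont_onB cA caff).
move=> t tt.
have -> : f (z s t) * kappa t - (c * kappa t + D * s%:C * ('i%C * x t)) =
    (f (z s t) - (c + D * (s%:C * e t))) * kappa t.
  have -> : 'i%C * x t = e t * kappa t.
    by rewrite /kappa; have := e0 t; move: (e t) => u u0; field.
  by ring.
by rewrite cabsM; apply: ler_pM; rewrite ?cabs_ge0//; exact: close.
Qed.

Let B_aff t : t1 <= t <= t2 ->
  cabs (B t s1 s2 - (c * cint s1 s2 (fun s => (s%:C)^-1) + D * e t * (s2 - s1)%:C))
    <= 2 * (eta / del * (s2 - s1)).
Proof.
move=> tt; have cV := @contV s1 s2 s10.
have c1 := @cont_on_cst R s1 s2 (D * e t).
rewrite -(cint_cst (D * e t) s12) -(cintZ c cV).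
rewrite -(cintD (cont_onZ (c := c) cV) c1).
have cB := @contB t s1 s2 s10 s21.
have caff := cont_onD (cont_onZ (c := c) cV) c1.
rewrite -(cintB cB caff).
apply: (cint_bound s12); first exact: (cont_onB cB caff).
move=> s ss.
have s_del : del <= s by case/andP: ss => s1s _; exact: le_trans s1s.
have s_gt0 : 0 < s by exact: lt_le_trans s_del.
have sn0 : s%:C != 0 :> C by rewrite -cabs_gt0 cabs_real normr_gt0 gt_eqF.
have -> : f (z s t) * (s%:C)^-1 - (c * (s%:C)^-1 + D * e t) =
    (f (z s t) - (c + D * (s%:C * e t))) * (s%:C)^-1.
  by move: (f _) (e _) => u v; field.
rewrite cabsM; apply: ler_pM; rewrite ?cabs_ge0//; first exact: close.
by rewrite cabsV cabs_real gtr0_norm// lef_pV2.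
Qed.

(** For an affine function c + D (z - a) the four sides cancel exactly: the terms in [c] cancel
    between opposite sides, and those in [D] telescope to differences of [s e(t)] at the corners.
    Only the error [eta] remains, integrated against [kappa] (at most [K]) and against 1/s (at most
    [del^-1]); [del] keeps the rectangle away from the singularity at [s = 0]. *)
Lemma J_affine_bound :
  cabs (J s1 s2 t1 t2) <= 4 * eta * (K + del^-1) * ((s2 - s1) + (t2 - t1)).
Proof.
have t1m : t1 <= t1 <= t2 by rewrite lexx.
have t2m : t1 <= t2 <= t2 by rewrite lexx t12.
have s1m : s1 <= s1 <= s2 by rewrite lexx.
have s2m : s1 <= s2 <= s2 by rewrite lexx s12.
have := A_aff s1m; have := A_aff s2m; have := B_aff t1m; have := B_aff t2m.
set k := cint _ _ kappa; set l := cint _ _ _.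
set x1 := B t2 _ _ - _; set x2 := B t1 _ _ - _.
set x3 := A s2 _ _ - _; set x4 := A s1 _ _ - _ => h1 h2 h3 h4.
have -> : J s1 s2 t1 t2 = x3 - x4 - x1 + x2.
  by rewrite /J /x1 /x2 /x3 /x4 rmorphB; ring.
apply: (le_trans (cabsD_le _ _)).
apply: (@le_trans _ _ (cabs x3 + cabs x4 + cabs x1 + cabs x2)).
  rewrite lerD2r; apply: (le_trans (cabsB_le _ _)); rewrite lerD2r.
  exact: cabsB_le.
have eta0 : 0 <= eta by exact: le_trans (cabs_ge0 _) (close s1m t1m).
have d0 : 0 <= eta / del by rewrite divr_ge0// ltW.
have s21p : 0 <= s2 - s1 by rewrite subr_ge0.
have p1 : 0 <= eta * K * (s2 - s1).
  exact: (mulr_ge0 (mulr_ge0 eta0 (ltW K0)) s21p).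
have p2 : 0 <= eta / del * (t2 - t1) by rewrite mulr_ge0 ?subr_ge0.
move: h1 h2 h3 h4 d0 p1 p2.
by move: (cabs x1) (cabs x2) (cabs x3) (cabs x4) del^-1 => y1 y2 y3 y4 di; lra.
Qed.
End Local.

Let J0 del : 0 < del -> del <= 1 -> J del 1 0 (2 * pi) = 0.
Proof.
move=> del0 del1.
have pi0 : 0 <= 2 * pi :> R by rewrite mulr_ge0// pi_ge0.
apply: (rect_bisection del1 pi0).
- move=> s1 s2 s3 t1 t2 h1 h2 h3 h4 h5 h6 h7; rewrite /J.
  have sp t : B t s1 s3 = B t s1 s2 + B t s2 s3.
    apply: cint_split; first by rewrite h2.
    by apply: contB => //; exact: lt_le_trans h1.
  by rewrite !sp; ring.
- move=> s1 s2 t1 t2 t3 h1 h2 h3 h4 h5 h6 h7; rewrite /J.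
  have s2p : 0 <= s2 by rewrite (le_trans (ltW del0))// (le_trans h1).
  have sp s : s1 <= s <= s2 -> A s t1 t3 = A s t1 t2 + A s t2 t3.
    move=> /andP[ss1 ss2].
    apply: cint_split; first by rewrite h5.
    apply: contA; rewrite (le_trans _ h3)// andbT.
    by rewrite (le_trans (ltW del0))// (le_trans h1).
  rewrite !sp ?lexx ?h2//; ring.
move=> s0 t0 eps /andP[ds0 s01] t0p eps0.
have s0p : 0 <= s0 <= 1 by rewrite s01 andbT (le_trans (ltW del0)).
have [D HD] := (derivableCP _ _).1 (df (@Nz s0 t0 s0p)).
(* [L] is a Lipschitz constant of [z] with respect to the sum of the variations of [s] and [t]: the
   modulus of [e] is at most [2 * r], and [cis] is 2-Lipschitz. *)
pose L := 2 * r.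
have L0 : 0 < L by rewrite mulr_gt0.
have Kd : 0 < K + del^-1 by rewrite addr_gt0// invr_gt0.
(* With error [eta * (L * w)] on the rectangle, the bound of [J_affine_bound] becomes exactly
   [eps * w ^+ 2]. *)
pose eta := eps / (4 * L * (K + del^-1)).
have eta0 : 0 < eta by rewrite divr_gt0// !mulr_gt0.
have [d d0 dP] := HD _ eta0.
exists (d / L); first by rewrite divr_gt0.
move=> s1 s2 t1 t2 h1 h2 h3 h4 h5 h6.
set w := (s2 - s1) + (t2 - t1) => wd.
have [/andP[h2a h2b] /andP[h5a h5b]] := (h2, h5).
have s12 := le_trans h2a h2b; have t12 := le_trans h5a h5b.
have w0 : 0 <= w by rewrite addr_ge0 ?subr_ge0.
have Lw : forall s t, s1 <= s <= s2 -> t1 <= t <= t2 -> cabs (z s t - z s0 t0) <= L * w.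
  move=> s t ss tt.
  have -> : z s t - z s0 t0 = (s - s0)%:C * e t + s0%:C * (e t - e t0).
    by rewrite /z rmorphB; ring.
  apply: (le_trans (cabsD_le _ _)); rewrite (cabsM (s - s0)%:C) (cabsM s0%:C) !cabs_real.
  have -> : e t - e t0 = r%:C * (cis t - cis t0) by rewrite /e /x; ring.
  rewrite cabsM cabs_real (gtr0_norm r0).
  have e1 : `|s - s0| <= s2 - s1 by rewrite ler_norml; lra.
  have e2 : `|t - t0| <= t2 - t1 by rewrite ler_norml; lra.
  rewrite /L /w mulrDr; apply: lerD.
    by rewrite mulrC; apply: ler_pM; rewrite ?cabs_ge0.
  rewrite -[leRHS]mul1r; apply: ler_pM => //.
  - by rewrite mulr_ge0 ?cabs_ge0// ltW.
  - by rewrite ger0_norm//; lra.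
  rewrite [leRHS](_ : _ = r * (2 * (t2 - t1))); last by rewrite mulrCA mulrA.
  rewrite ler_pM2l//; apply: (le_trans (cis_lip _ _)).
  by rewrite ler_pM2l.
(* The tangent map of [f] at [z s0 t0], rewritten as an affine function of z - a. *)
have := @J_affine_bound (f (z s0 t0) + D * (a - z s0 t0)) D (eta * (L * w))
  s1 s2 t1 t2 del del0 h1 s12 h3 t12 _.
rewrite -/w => H; apply: le_trans (H _) _.
  move=> s t ss tt.
  have := dP (z s t); have zL := Lw s t ss tt.
  have -> : f (z s t) - f (z s0 t0) - D * (z s t - z s0 t0) =
      f (z s t) - (f (z s0 t0) + D * (a - z s0 t0) + D * (s%:C * e t)).
    have -> : z s t = a + s%:C * e t by [].
    by ring.
  move=> HH; apply: (le_trans (HH _)).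
    by apply: (le_lt_trans zL); rewrite mulrC -ltr_pdivlMr.
  by rewrite ler_pM2l.
rewrite /eta le_eqVlt; apply/orP; left; apply/eqP.
have : 4 * L * (K + del^-1) != 0 by rewrite gt_eqF// !mulr_gt0.
have L00 : L != 0 by rewrite gt_eqF.
have Kd0 : K + del^-1 != 0 by rewrite gt_eqF.
move: (K + del^-1) Kd0 => k k0 _.
by field; rewrite k0 L00.
Qed.

Let Phi s := cint 0 (2 * pi) (fun t => f (z s t) * (x t / e t)).
Let pi20 : 0 <= 2 * pi :> R. Proof. by rewrite mulr_ge0// pi_ge0. Qed.

(** The sides [t = 0] and [t = 2 * pi] of the parameter rectangle have the same image and cancel in
    [J], which leaves the two closed curves [s = del] and [s = 1]. *)
Let Phi_cst del : 0 < del -> del <= 1 -> Phi 1 = Phi del.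
Proof.
move=> d0 d1; have := J0 d0 d1; rewrite /J.
have -> : B (2 * pi) del 1 = B 0 del 1.
  by apply: eq_cint => s _; rewrite /z /e /x cis2pi cis0.
have AE s : 0 <= s <= 1 -> A s 0 (2 * pi) = 'i%C * Phi s.
  move=> s01; rewrite /Phi -cintZ.
    by apply: eq_cint => t _; rewrite /kappa mulrCA.
  by move=> t _; apply: cvgCM; [exact: cfz_t|exact: cxe].
rewrite subrK !AE ?lexx ?ler01//; last by rewrite d1 ltW.
have i0 : 'i%C != 0 :> C by rewrite -cabs_gt0 cabs_i.
by rewrite -mulrBr => /eqP; rewrite mulf_eq0 (negPf i0)/= subr_eq0 => /eqP.
Qed.

(** As [del] tends to 0 the curve [s = del] shrinks to [a], so [f] on it tends to [f a] uniformly in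
    [t], while [Phi del] does not move. *)
Let Phi1 : Phi 1 = f a * cint 0 (2 * pi) (fun t => x t / e t).
Proof.
apply/eqP; rewrite -subr_eq0 -cabs_eq0 eq_le cabs_ge0 andbT; apply/ler_addgt0Pl => eps eps0.
rewrite addr0.
have cq : cont_on 0 (2 * pi) (fun t => x t / e t) by move=> t _; exact: cxe.
have pi1 : 0 < 2 * pi + 1 :> R by rewrite ltr_wpDl.
have M0 : 0 < 2 * (K * (2 * pi + 1)) by rewrite (mulr_gt0 _ (mulr_gt0 K0 pi1)).
have a_rho : cabs a < rho by exact: lt_trans r_rho.
have fa := (@cvgC_cabsP R C (nbhs a) _ f (f a)).1 (derivableC_continuous (df a_rho)).
have eps' : 0 < eps / (2 * (K * (2 * pi + 1))) by rewrite divr_gt0.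
have [d d0 dP] := (nbhsCP _ _).1 (fa (nbhs_filter a) _ eps').
pose del := Num.min 1 (d / (2 * r + 1)).
have r1 : 0 < 2 * r + 1 by rewrite ltr_wpDl// mulr_ge0// ltW.
have del0 : 0 < del by rewrite lt_min ltr01 divr_gt0.
have del1 : del <= 1 by rewrite ge_min lexx.
have del01 : 0 <= del <= 1 by rewrite del1 ltW.
rewrite (Phi_cst del0 del1) -(cintZ (f a) cq).
have cP : cont_on 0 (2 * pi) (fun t => f (z del t) * (x t / e t)).
  by move=> t _; apply: cvgCM; [exact: cfz_t|exact: cxe].
rewrite -(cintB cP (cont_onZ (c := f a) cq)).
apply: (@le_trans _ _ (2 * ((eps / (2 * (K * (2 * pi + 1))) * K) * (2 * pi - 0)))).
  apply: (cint_bound pi20); first exact: (cont_onB cP (cont_onZ (c := f a) cq)).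
  move=> t _; rewrite -mulrBl cabsM; apply: ler_pM; rewrite ?cabs_ge0//.
  apply/ltW/dP; rewrite addrAC subrr add0r cabsM cabs_real gtr0_norm//.
  apply: (@le_lt_trans _ _ (del * (2 * r))).
    by rewrite ler_pM2l.
  apply: (@lt_le_trans _ _ (del * (2 * r + 1))); first by rewrite ltr_pM2l// ltrDl.
  by rewrite -ler_pdivlMr// ge_min lexx orbT.
rewrite subr0.
have -> : 2 * (eps / (2 * (K * (2 * pi + 1))) * K * (2 * pi)) =
    eps * ((2 * pi) / (2 * pi + 1)).
  have K00 : K != 0 by rewrite gt_eqF.
  have : 2 * pi + 1 != 0 :> R by rewrite gt_eqF// ltr_wpDl.
  by move: (2 * pi) => u u0; field; rewrite u0 K00.
rewrite ger_pMr//; rewrite ler_pdivrMr ?ltr_wpDl// mul1r lerDl//.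
Qed.

Let geom (u v : C) n : v != 0 -> v - u != 0 ->
  v / (v - u) = \sum_(k < n) (u / v) ^+ k + (u / v) ^+ n * (v / (v - u)).
Proof.
move=> v0 vu; elim: n => [|n IH]; first by rewrite big_ord0 add0r mul1r.
rewrite big_ord_recr /= {1}IH -addrA; congr (_ + _).
by rewrite exprSr; move: (_ ^+ n) => w; field; rewrite v0 vu.
Qed.

Let cxn k (t : R) : (fun t => (x t)^-1 ^+ k) @ t --> (x t)^-1 ^+ k.
Proof. by apply: cvgCX; apply: cvgCV; [exact: x0|exact: cx]. Qed.

(* The expansion of [x/(x - a)] in powers of [a/x], integrated termwise. *)
Lemma cint_geom (g : R -> C) n M :
  (forall t, 0 <= t <= 2 * pi -> cabs (g t) <= M) -> cont_on 0 (2 * pi) g ->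
  cabs (cint 0 (2 * pi) (fun t => g t * (x t / e t)) -
     \sum_(k < n) a ^+ k * cint 0 (2 * pi) (fun t => g t * (x t)^-1 ^+ k))
  <= 2 * (M * (cabs a / r) ^+ n * K * (2 * pi)).
Proof.
move=> gM cg.
have cgk k : cont_on 0 (2 * pi) (fun t => g t * (x t)^-1 ^+ k).
  by move=> t tp; apply: cvgCM; [exact: cg|exact: cxn].
have cgx : cont_on 0 (2 * pi) (fun t => g t * (x t / e t)).
  by move=> t tp; apply: cvgCM; [exact: cg|exact: cxe].
have -> : \sum_(k < n) a ^+ k * cint 0 (2 * pi) (fun t => g t * (x t)^-1 ^+ k) =
    cint 0 (2 * pi) (fun t => \sum_(k < n) a ^+ k * (g t * (x t)^-1 ^+ k)).
  rewrite cint_sum; last by move=> k; exact: (cont_onZ (c := a ^+ k) (cgk k)).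
  by apply: eq_bigr => k _; rewrite (cintZ (a ^+ k) (cgk k)).
have cS : cont_on 0 (2 * pi) (fun t => \sum_(k < n) a ^+ k * (g t * (x t)^-1 ^+ k)).
  elim: n => [|n IH].
    have -> : (fun t => \sum_(k < 0) a ^+ k * (g t * (x t)^-1 ^+ k)) = fun=> 0.
      by apply/funext => t; rewrite big_ord0.
    exact: cont_on_cst.
  have -> : (fun t => \sum_(k < n.+1) a ^+ k * (g t * (x t)^-1 ^+ k)) =
     fun t => \sum_(k < n) a ^+ k * (g t * (x t)^-1 ^+ k) +
              a ^+ n * (g t * (x t)^-1 ^+ n).
    by apply/funext => t; rewrite big_ord_recr.
  exact: (cont_onD IH (cont_onZ (c := a ^+ n) (cgk n))).
rewrite -(cintB cgx cS) -[X in _ * _ * X]subr0.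
apply: (cint_bound pi20); first exact: (cont_onB cgx cS).
move=> t tp.
have -> : g t * (x t / e t) - \sum_(k < n) a ^+ k * (g t * (x t)^-1 ^+ k) =
    g t * (a / x t) ^+ n * (x t / e t).
  rewrite {1}(geom n (x0 t) (e0 t)) mulrDr -mulrA -[RHS]add0r addrAC.
  congr (_ + _); rewrite mulr_sumr -sumrB big1// => k _.
  by rewrite exprMn mulrCA subrr.
rewrite (cabsM (g t * _)) (cabsM (g t)).
apply: ler_pM; rewrite ?mulr_ge0 ?cabs_ge0//.
apply: ler_pM; rewrite ?cabs_ge0//; first exact: gM.
by rewrite cabsX cabsM cabsV Nx.
Qed.

(** In the expansion of x/(x - a) in powers of a/x only the constant term survives integration over
    the circle, and the remainder decays geometrically. *)
Let cint_xe : cint 0 (2 * pi) (fun t => x t / e t) = (2 * pi)%:C.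
Proof.
apply/eqP; rewrite -subr_eq0 -cabs_eq0 eq_le cabs_ge0 andbT.
apply: (@exp_arbitrarily_small _ (cabs a / r) (2 * (K * (2 * pi)) * (cabs a / r))).
  by rewrite divr_ge0 ?cabs_ge0 ?ltW//= ltr_pdivrMr// mul1r.
move=> n.
have g1 (t : R) : 0 <= t <= 2 * pi -> cabs (1 : C) <= 1 by rewrite cabs1.
have := cint_geom n.+1 g1 (@cont_on_cst R 0 (2 * pi) 1).
have -> : cint 0 (2 * pi) (fun t => 1 * (x t / e t)) =
    cint 0 (2 * pi) (fun t => x t / e t).
  by apply: eq_cint => t _; rewrite mul1r.
rewrite big_ord_recl /= big1 ?addr0; last first.
  move=> k _; rewrite (@eq_cint _ _ _ _ (fun t => r%:C^-1 ^+ k.+1 * (cis t)^-1 ^+ k.+1)).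
    rewrite cintZ ?cint_cisX ?mulr0//.
    by move=> t _; apply: cvgCX; apply: cvgCV; [exact: cis_neq0|exact: continuous_cis].
  by move=> t _; rewrite mul1r /x invfM exprMn.
have -> : cint 0 (2 * pi) (fun t => 1 * (x t)^-1 ^+ 0) = (2 * pi)%:C.
  rewrite (@eq_cint _ _ _ _ (fun=> 1)); last by move=> t _; rewrite mul1r.
  by rewrite (cint_cst 1 pi20) mul1r subr0.
rewrite expr0 [X in cabs (_ - X)]mul1r => H; apply: (le_trans H).
by rewrite mul1r exprS le_eqVlt; apply/orP; left; apply/eqP; ring.
Qed.

(** On the circle dx = i x dt, so the right-hand side is the contour integral of f(x)/(x - a)
    divided by i. *)
Theorem cauchy_formula :
  (2 * pi)%:C * f a = cint 0 (2 * pi) (fun t => f (x t) * (x t / e t)).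
Proof.
rewrite mulrC -cint_xe -Phi1; apply: eq_cint => t _.
by rewrite /z /e mul1r addrC subrK.
Qed.

End Cauchy.

(** * Taylor expansions and boundary values *)

Section Taylor.
Variable R : realType.
Local Notation C := R[i].
Local Notation mu := (@lebesgue_measure R).

Let pi20 : 0 <= 2 * pi :> R. Proof. by rewrite mulr_ge0// pi_ge0. Qed.
Let pi2_gt0 : 0 < 2 * pi :> R. Proof. by rewrite mulr_gt0// pi_gt0. Qed.

Lemma continuous_circle (f : C -> C) (rho r : R) :
  (forall z, cabs z < rho -> derivable f z 1) -> 0 <= r < rho ->
  forall t : R, (fun t => f (r%:C * cis t)) @ t --> f (r%:C * cis t).
Proof.
move=> df /andP[r0 rrho] t.
have cx : (fun t : R => r%:C * cis t) @ t --> r%:C * cis t.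
  by apply: cvgCM; [exact: cvgC_cst|exact: continuous_cis].
apply: cvg_comp cx _; apply: derivableC_continuous; apply: df.
by rewrite cabsM cabs_cis cabs_real mulr1 ger0_norm.
Qed.

Lemma circle_bound (f : C -> C) (rho r : R) :
  (forall z, cabs z < rho -> derivable f z 1) -> 0 <= r < rho ->
  exists2 M, 0 <= M &
    forall t : R, 0 <= t <= 2 * pi -> cabs (f (r%:C * cis t)) <= M.
Proof.
move=> df rr.
have [||c cP H] := @EVT_max R (fun t => cabs (f (r%:C * cis t))) 0 (2 * pi).
- exact: pi20.
- apply: continuous_subspaceT => t.
  by apply: cvgC_cabs; exact: (continuous_circle df rr).
exists (cabs (f (r%:C * cis c))); first exact: cabs_ge0.
by move=> t tp; apply: H; rewrite in_itv.
Qed.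

(** The coefficients are Cauchy integrals over the circle of radius [r], and the remainder is that
    of the geometric expansion of the kernel. [M] is twice a bound of [f] on this circle, the 2
    being that of [cint_bound]. *)
Lemma taylor (f : C -> C) (rho r : R) :
  (forall z, cabs z < rho -> derivable f z 1) -> 0 < r < rho ->
  exists c M, [/\ 0 <= M, forall k, cabs (c k) <= M / r ^+ k &
    forall n z, cabs z < r ->
      cabs (f z - \sum_(k < n) c k * z ^+ k) <= M * (cabs z / r) ^+ n * (r / (r - cabs z))].
Proof.
move=> df /andP[r0 rrho].
have rr : 0 <= r < rho by rewrite ltW.
have [M0 M00 M0P] := circle_bound df rr.
pose g t := f (r%:C * cis t).
have cg : cont_on 0 (2 * pi) g by move=> t _; exact: (continuous_circle df rr).
have x0 t : r%:C * cis t != 0.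
  by rewrite -cabs_gt0 cabsM cabs_cis cabs_real mulr1 gtr0_norm.
pose c k := ((2 * pi)%:C)^-1 * cint 0 (2 * pi) (fun t => g t * (r%:C * cis t)^-1 ^+ k).
have Npi : cabs (2 * pi)%:C = 2 * pi :> R by rewrite cabs_real gtr0_norm.
have pi0 : (2 * pi)%:C != 0 :> C by rewrite -cabs_gt0 Npi.
exists c, (2 * M0); split; first by rewrite mulr_ge0.
  move=> k; rewrite cabsM cabsV Npi.
  rewrite ler_pdivrMl//.
  have -> : 2 * pi * (2 * M0 / r ^+ k) = 2 * (M0 * (r ^+ k)^-1 * (2 * pi - 0)).
    by rewrite subr0; ring.
  apply: (cint_bound pi20).
    apply: (cont_onM cg) => t _; apply: cvgCX; apply: cvgCV; first exact: x0.
    by apply: cvgCM; [exact: cvgC_cst|exact: continuous_cis].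
  move=> t tp; rewrite cabsM; apply: ler_pM; rewrite ?cabs_ge0//; first exact: M0P.
  by rewrite cabsX cabsV cabsM cabs_cis cabs_real mulr1 gtr0_norm// exprVn.
move=> n z zr.
have := @cint_geom R r z zr g n M0 M0P cg.
rewrite -(cauchy_formula df rrho zr) => H.
rewrite -(ler_pM2l pi2_gt0) -{1}Npi -cabsM mulrBr mulr_sumr.
have -> : \sum_(k < n) (2 * pi)%:C * (c k * z ^+ k) =
    \sum_(k < n) z ^+ k * cint 0 (2 * pi) (fun t => g t * (r%:C * cis t)^-1 ^+ k).
  by apply: eq_bigr => k _; rewrite /c mulrA mulVKf// mulrC.
apply: (le_trans H); rewrite le_eqVlt; apply/orP; left; apply/eqP.
by move: (r / _) (_ ^+ _) => u v; ring.
Qed.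

End Taylor.

(** * Bounds inside the disc from radial limits *)

Section Boundary.
Variable R : realType.
Local Notation C := R[i].
Local Notation mu := (@lebesgue_measure R).
Let pi20 : 0 <= 2 * pi :> R. Proof. by rewrite mulr_ge0// pi_ge0. Qed.
Let pi2_gt0 : 0 < 2 * pi :> R. Proof. by rewrite mulr_gt0// pi_gt0. Qed.

Lemma ae_sub (P Q : R -> Prop) : (forall t, P t -> Q t) ->
  {ae mu, forall t, P t} -> {ae mu, forall t, Q t}.
Proof.
move=> PQ; apply: filterS => //; exact: (ae_filter_ringOfSetsType mu).
Qed.

Lemma cvg_at_left_seq (u : nat -> R) (p : R) :
  (forall n, u n < p) -> u @ \oo --> p -> u @ \oo --> p^'-.
Proof.
move=> up cu A; rewrite /at_left /within /= => H.
have : \forall n \near \oo, u n < p -> A (u n) by exact: (cu _ H).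
by apply: filterS => n; apply.
Qed.

Lemma cvg_maxr (T : Type) (F : set_system T) (FF : Filter F) (f : T -> R) (l M : R) :
  f @ F --> l -> (fun x => Num.max (f x) M) @ F --> Num.max l M.
Proof.
move=> /cvgrPdist_lt fl; apply/cvgrPdist_lt => e e0.
have := fl _ e0; apply: filterS => x; apply: le_lt_trans.
move: (f x) => y; rewrite ler_norml.
have h1 := ler_norm (l - y); have h2 := ler_norm (y - l); rewrite distrC in h2.
move: `|l - y| h1 h2 => u h1 h2.
by case: (leP l M) => h3; case: (leP y M) => h4; apply/andP; split; lra.
Qed.

Definition radial_limit (h : C -> C) (t : R) (l : C) :=
  h (r%:C * cis t) @[r --> (1 : R)^'-] --> l.

Lemma cauchy_circle_bound (h : C -> C) (a : C) (r : R) :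
  (forall z, cabs z < 1 -> derivable h z 1) -> cabs a < r < 1 ->
  2 * pi * cabs (h a) <= 2 * (r / (r - cabs a)) *
     \int[mu]_(t in `[0, 2 * pi]) cabs (h (r%:C * cis t)).
Proof.
move=> dh /andP[ar r1].
have r0 : 0 < r := le_lt_trans (cabs_ge0 a) ar.
have rr : 0 <= r < 1 by rewrite r1 (ltW r0).
have Npi : cabs (2 * pi)%:C = 2 * pi :> R by rewrite cabs_real gtr0_norm.
have ra0 : 0 < r - cabs a by rewrite subr_gt0.
have rn0 : 0 <= r by exact: ltW.
have xa (t : R) : r - cabs a <= cabs (r%:C * cis t - a).
  apply: le_trans (cabs_lerB _ _).
  by rewrite cabsM cabs_cis cabs_real mulr1 gtr0_norm.
have cx (t : R) : (fun t : R => r%:C * cis t) @ t --> r%:C * cis t.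
  by apply: cvgCM; [exact: cvgC_cst|exact: continuous_cis].
have ch := continuous_circle dh rr.
have cq : cont_on 0 (2 * pi) (fun t => r%:C * cis t / (r%:C * cis t - a)).
  move=> t _; apply: cvgCM; first exact: cx.
  apply: cvgCV; last by apply: cvgCB; [exact: cx|exact: cvgC_cst].
  by rewrite -cabs_gt0; exact: lt_le_trans (xa t).
have ci : cont_on 0 (2 * pi) (fun t => h (r%:C * cis t) *
    (r%:C * cis t / (r%:C * cis t - a))).
  by apply: (cont_onM _ cq) => t _; exact: ch.
rewrite -{1}Npi -cabsM (cauchy_formula dh r1 ar).
apply: (le_trans (cint_norm ci)); rewrite -mulrA ler_pM2l//.
have mab : measurable (`[0, 2 * pi]%classic : set R) by exact: measurable_itv.
have ih : mu.-integrable `[0, 2 * pi] (EFin \o (fun t => cabs (h (r%:C * cis t)))).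
  by apply: continuous_integrable => t _; apply: cvgC_cabs; exact: ch.
rewrite -(@RintegralZl _ _ R mu _ _ _ mab ih).
apply: (@le_Rintegral _ _ R mu _ _ _ mab).
- by apply: continuous_integrable => t tt; apply: cvgC_cabs; exact: ci.
- exact: integrable_scale.
- move=> t _; rewrite cabsM mulrC; apply: ler_pM; rewrite ?cabs_ge0//.
  rewrite cabsM cabsV cabsM cabs_cis cabs_real mulr1 gtr0_norm// ler_pM2l//.
  by rewrite lef_pV2 ?posrE//; exact: lt_le_trans (xa t).
Qed.

(** Cauchy's formula on circles of radius tending to 1, with dominated convergence under the uniform
    bound [B]. The constant is [2 * (2 / (1 - cabs a))]: one 2 from [cint_norm], the other because
    the radii stay at distance at least [(1 - cabs a) / 2] from the modulus of [a]. *)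
Lemma boundary_bound_const (h : C -> C) (M B : R) (a : C) : 0 <= M ->
  (forall z, cabs z < 1 -> derivable h z 1) -> (forall z, cabs z < 1 -> cabs (h z) <= B) ->
  {ae mu, forall t, t \in `[0, 2 * pi[ -> exists2 l, radial_limit h t l & cabs l <= M} ->
  cabs a < 1 -> cabs (h a) <= 4 / (1 - cabs a) * M.
Proof.
move=> M0 dh hB hM a1.
(* The radii start at [(1 + cabs a) / 2] and increase to 1. *)
pose r (n : nat) : R := 1 - (1 - cabs a) / 2 * n.+1%:R^-1.
have a10 : 0 < 1 - cabs a by rewrite subr_gt0.
have in0 (n : nat) : 0 < n.+1%:R^-1 :> R by rewrite invr_gt0.
have in1 (n : nat) : n.+1%:R^-1 <= 1 :> R by rewrite invf_le1// ler1n.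
have r1 n : r n < 1 by rewrite /r ltrBlDr ltrDl !mulr_gt0.
have ra n : (1 + cabs a) / 2 <= r n.
  have : (1 - cabs a) / 2 * n.+1%:R^-1 <= (1 - cabs a) / 2 * 1.
    by rewrite ler_pM2l// divr_gt0.
  by rewrite /r; move: (cabs a) n.+1%:R^-1 => u v; lra.
have ar n : cabs a < r n by apply: lt_le_trans (ra n); lra.
have r0 n : 0 < r n := le_lt_trans (cabs_ge0 a) (ar n).
have cr : r @ \oo --> (1 : R).
  have : (fun n => (1 : R) - (1 - cabs a) / 2 * n.+1%:R^-1) @ \oo -->
      (1 : R) - (1 - cabs a) / 2 * 0.
    apply: cvgB; first exact: cvg_cst.
    by apply: cvgM; [exact: cvg_cst|exact: cvg_harmonic].
  by rewrite mulr0 subr0.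
have crl := cvg_at_left_seq r1 cr; clearbody r.
pose H n t := cabs (h ((r n)%:C * cis t)).
pose G n t := Num.max (H n t) M.
have cH n (t : R) : H n @ t --> H n t.
  apply: cvgC_cabs; apply: (continuous_circle dh).
  by rewrite r1 ltW.
have cG n (t : R) : G n @ t --> G n t.
  exact: (cvg_maxr (nbhs_filter t) (cH n t)).
have mab : measurable (`[0, 2 * pi]%classic : set R) by exact: measurable_itv.
have mab' : measurable (`[0, 2 * pi[%classic : set R) by exact: measurable_itv.
have sub : `[0, 2 * pi[%classic `<=` (`[0, 2 * pi]%classic : set R).
  by apply: subset_itvl; rewrite bnd_simp.
have iG n : mu.-integrable `[0, 2 * pi] (EFin \o G n).
  by apply: continuous_integrable => t _; exact: cG.
have iG' n : mu.-integrable `[0, 2 * pi[ (EFin \o G n).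
  exact: (@integrableS _ _ R mu _ _ _ mab mab' sub (iG n)).
have icst (c : R) : mu.-integrable `[0, 2 * pi[ (EFin \o (fun=> c)).
  apply: (@integrableS _ _ R mu _ _ _ mab mab' sub).
  by apply: continuous_integrable => t _; exact: cvg_cst.
have step n : 2 * pi * cabs (h a) <= 4 / (1 - cabs a) * \int[mu]_(t in `[0, 2 * pi[) G n t.
  have arn : cabs a < r n < 1 by rewrite ar r1.
  apply: (le_trans (cauchy_circle_bound dh arn)).
  apply: ler_pM.
  - by rewrite mulr_ge0// divr_ge0 ?subr_ge0 ?(ltW (r0 n)) ?(ltW (ar n)).
  - by apply: Rintegral_ge0 => t _ /=; exact: cabs_ge0.
  - have ran : 0 < r n - cabs a by rewrite subr_gt0.
    have : 2 / (1 - cabs a) * (r n - cabs a) >= 1.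
      rewrite mulrAC ler_pdivlMr// mul1r; have := ra n.
    by move: (r n) (cabs a) => u v; lra.
    rewrite mulrA ler_pdivrMr// => h1.
    have -> : 4 / (1 - cabs a) * (r n - cabs a) = 2 * (2 / (1 - cabs a) * (r n - cabs a)).
      by ring.
    have := r1 n; move: h1; move: (r n) (2 / _ * _) => u v; lra.
  rewrite Rintegral_itv_bndo_bndc//.
  apply: (@le_Rintegral _ _ R mu _ _ _ mab) => //.
    by apply: continuous_integrable => t _; exact: cH.
  by move=> t _; rewrite /G le_max lexx.
have aecv : {ae mu, forall t, `[0, 2 * pi[%classic t ->
    (EFin \o G n) t @[n --> \oo] --> (EFin \o (fun=> M)) t}.
  apply: ae_sub hM => t Ht /Ht[l lt lM].
  have Hl : (fun n => H n t) @ \oo --> cabs l.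
    by apply: cvgC_cabs; apply: cvg_comp crl lt.
  apply: cvg_EFin; first exact: nearW.
  by have := cvg_maxr (M := M) _ Hl; rewrite (max_r lM); apply.
have aebd : {ae mu, forall t n, `[0, 2 * pi[%classic t ->
    (`|(EFin \o G n) t| <= (EFin \o (fun=> Num.max B M)) t)%E}.
  apply: aeW => t n _; rewrite /= lee_fin.
  have HB : H n t <= B by apply: hB; rewrite cabsM cabs_cis cabs_real mulr1 (gtr0_norm (r0 n)).
  rewrite /G; move: (H n t) HB => u uB.
  have : 0 <= Num.max u M by rewrite le_max M0 orbT.
  move=> /ger0_norm ->.
  by case: (leP u M) => h1; case: (leP B M) => h2 //; rewrite ?(ltW h2)//; lra.
have [_ _] := @dominated_convergence _ _ R mu _ mab' (fun n => EFin \o G n)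
  (EFin \o (fun=> M)) _ (fun n => measurable_int mu (iG' n))
  (measurable_int mu (icst M)) aecv (icst (Num.max B M)) aebd.
have -> : (\int[mu]_(x in `[0%R, (2 * pi)%R[) (EFin \o (fun=> M)) x = (M * (2 * pi))%:E)%E.
  rewrite integral_cst// /= lebesgue_measure_itv /= lte_fin pi2_gt0.
  by rewrite -EFinB subr0.
move=> /fine_cvgP[_ cI].
have lim_le : 2 * pi * cabs (h a) <= 4 / (1 - cabs a) * (M * (2 * pi)).
  have cI' : (fun n => 4 / (1 - cabs a) * \int[mu]_(t in `[0, 2 * pi[) G n t) @ \oo -->
      4 / (1 - cabs a) * (M * (2 * pi)).
    by apply: cvgM cI; exact: cvg_cst.
  rewrite -(cvg_lim _ cI')//; apply: limr_ge; first exact: cvgP cI'.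
  by apply: nearW => n; exact: step.
rewrite -(ler_pM2l pi2_gt0); apply: (le_trans lim_le).
by rewrite le_eqVlt; apply/orP; left; apply/eqP; ring.
Qed.

(* The multiplicative constant disappears on applying the previous bound to the
   powers of [h]. *)
Lemma boundary_bound (h : C -> C) (M B : R) : 0 <= M ->
  (forall z, cabs z < 1 -> derivable h z 1) -> (forall z, cabs z < 1 -> cabs (h z) <= B) ->
  {ae mu, forall t, t \in `[0, 2 * pi[ -> exists2 l, radial_limit h t l & cabs l <= M} ->
  forall a, cabs a < 1 -> cabs (h a) <= M.
Proof.
move=> M0 dh hB hM a a1; rewrite leNgt; apply/negP => My.
have y0 : 0 < cabs (h a) := le_lt_trans M0 My.
suff : (1 : R) <= 0 by rewrite ler10.
apply: (@exp_arbitrarily_small _ (M / cabs (h a)) (4 / (1 - cabs a))).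
  by rewrite divr_ge0 ?cabs_ge0//= ltr_pdivrMr// mul1r.
move=> n; rewrite exprMn mulrA exprVn ler_pdivlMr ?exprn_gt0// mul1r -cabsX.
apply: (@boundary_bound_const (fun z => h z ^+ n) _ (B ^+ n)).
- by rewrite exprn_ge0.
- by move=> z z1; apply: derivableCX; exact: dh.
- by move=> z z1; rewrite cabsX lerXn2r ?nnegrE ?cabs_ge0//;
    [exact: le_trans (cabs_ge0 _) (hB _ z1)|exact: hB].
- apply: ae_sub hM => t Ht /Ht[l lt lM]; exists (l ^+ n).
    exact: cvgCX.
  by rewrite cabsX lerXn2r ?nnegrE ?cabs_ge0.
- exact: a1.
Qed.

End Boundary.

(** * Zeros, maximum principle and removable singularities *)

Section Local.
Variable R : realType.
Local Notation C := R[i].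

Lemma le_of_small (x y L d : R) : 0 < d -> 0 <= L ->
  (forall s, 0 < s < d -> y <= x + L * s) -> y <= x.
Proof.
move=> d0 L0 H; apply/ler_addgt0Pl => e e0.
pose s := Num.min (d / 2) (e / (L + 1)).
have L1 : 0 < L + 1 by rewrite ltr_wpDl.
have s0 : 0 < s by rewrite lt_min !divr_gt0.
have sd : s < d by rewrite gt_min ltr_pdivrMr// ltr_pMr// ltr1n.
have := H s; rewrite s0 sd => /(_ isT) Hs.
apply: (le_trans Hs); rewrite addrC lerD2r.
apply: (@le_trans _ _ ((L + 1) * s)); first by rewrite ler_pM2r// lerDl.
by rewrite mulrC -ler_pdivlMr// ge_min lexx orbT.
Qed.

Lemma taylor_at (f : C -> C) (b : C) (d r : R) :
  (forall z, cabs (z - b) < d -> derivable f z 1) -> 0 < r < d ->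
  exists (c : nat -> C) (M : R), 0 <= M /\
    forall n z, cabs (z - b) < r ->
      cabs (f z - \sum_(k < n) c k * (z - b) ^+ k) <=
      M * (cabs (z - b) / r) ^+ n * (r / (r - cabs (z - b))).
Proof.
move=> df rd; have [|c [M [M0 _ H]]] := @taylor R (fun w => f (w + b)) d r _ rd.
  by move=> z zd; apply: derivableC_shift; apply: df; rewrite addrK.
exists c, M; split=> // n z zr; have := H n (z - b) zr.
by rewrite subrK.
Qed.

Lemma local_expansion (f : C -> C) (b : C) (d r : R) :
  (forall z, cabs (z - b) < d -> derivable f z 1) -> 0 < r < d ->
  exists c : nat -> C,
    ((forall k, c k = 0) -> forall z, cabs (z - b) < r -> f z = 0) /\
    forall n, exists2 K, 0 <= K & forall z, cabs (z - b) < r / 2 ->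
      cabs (f z - \sum_(k < n) c k * (z - b) ^+ k) <= K * cabs (z - b) ^+ n.
Proof.
move=> df rd; have [c [M [M0 H]]] := taylor_at df rd; exists c.
have r0 : 0 < r by case/andP: rd.
split.
  move=> c0 z zr; apply/eqP; rewrite -cabs_eq0 eq_le cabs_ge0 andbT.
  apply: (@exp_arbitrarily_small _ (cabs (z - b) / r) (M * (r / (r - cabs (z - b))))).
    by rewrite divr_ge0 ?cabs_ge0 ?(ltW r0)//= ltr_pdivrMr// mul1r.
  move=> n; have := H n z zr.
  by rewrite big1 ?subr0 1?mulrAC// => k _; rewrite c0 mul0r.
(* On the half radius the factor [r / (r - cabs (z - b))] of the remainder is at most 2. *)
move=> n; exists (M * 2 / r ^+ n).
  by rewrite divr_ge0 ?mulr_ge0// exprn_ge0// ltW.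
move=> z zr; have zr' : cabs (z - b) < r.
  by apply: (lt_trans zr); rewrite ltr_pdivrMr// ltr_pMr// ltr1n.
apply: (le_trans (H n z zr')).
have -> : M * 2 / r ^+ n * cabs (z - b) ^+ n = M * (cabs (z - b) / r) ^+ n * 2.
  by rewrite exprMn exprVn; ring.
apply: ler_wpM2l.
  by rewrite mulr_ge0 ?exprn_ge0 ?divr_ge0 ?cabs_ge0// ltW.
rewrite ler_pdivrMr ?subr_gt0//; move: (cabs (z - b)) zr => u ur; lra.
Qed.

(** If some coefficient is nonzero, the first such term c_m (z - b)^m dominates the remainder, which
    is O(|z - b|^(m+1)), close to [b]. *)
Lemma isolated_or_zero (f : C -> C) (b : C) (d r : R) :
  (forall z, cabs (z - b) < d -> derivable f z 1) -> 0 < r < d ->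
  (forall z, cabs (z - b) < r -> f z = 0) \/
  (exists2 e, 0 < e & forall z, 0 < cabs (z - b) < e -> f z != 0).
Proof.
move=> df rd; have [c [c0 cP]] := local_expansion df rd.
have [c00|] := pselect (forall k, c k = 0); first by left; exact: c0.
move=> /existsNP[k0 /eqP ck0]; right.
have exk : exists k, c k != 0 by exists k0.
have [m cm mmin] := ex_minnP exk.
have [K K0 KP] := cP m.+1.
have r0 : 0 < r by case/andP: rd.
have Ncm : 0 < cabs (c m) by rewrite cabs_gt0.
have K1 : 0 < K + 1 by rewrite ltr_wpDl.
(* Below the second bound [K] times the distance to [b] is smaller than the modulus of [c m];
   [K + 1] covers the case [K = 0]. *)
exists (Num.min (r / 2) (cabs (c m) / (K + 1))).
  by rewrite lt_min !divr_gt0.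
move=> z /andP[z0]; rewrite lt_min => /andP[zr zc].
have := KP z zr; rewrite big_ord_recr /= big1 ?add0r; last first.
  move=> k _; suff -> : c k = 0 by rewrite mul0r.
  apply/eqP; apply: contraT => ck; have := mmin _ ck.
  by rewrite leqNgt ltn_ord.
move=> H; apply/eqP => fz; move: H; rewrite fz sub0r cabsN cabsM cabsX exprSr mulrA.
rewrite [leLHS]mulrC [leRHS]mulrAC [leRHS]mulrC ler_pM2l ?exprn_gt0//.
apply/negP; rewrite -ltNge.
move: zc; rewrite ltr_pdivlMr//; apply: le_lt_trans.
by rewrite mulrDr mulr1 mulrC lerDl ltW.
Qed.

Definition hol_disc (f : C -> C) := forall z, cabs z < 1 -> derivable f z 1.

Lemma hol_disc_ball (f : C -> C) b : hol_disc f ->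
  forall z, cabs (z - b) < 1 - cabs b -> derivable f z 1.
Proof.
move=> df z zb; apply: df; rewrite -(subrK b z).
by apply: (le_lt_trans (cabsD_le _ _)); rewrite -ltrBrDr.
Qed.

Lemma segment_disc (a b : C) (t m : R) : cabs a <= m -> cabs b <= m -> 0 <= t <= 1 ->
  cabs (b + t%:C * (a - b)) <= m.
Proof.
move=> am bm /andP[t0 t1].
have -> : b + t%:C * (a - b) = (1 - t)%:C * b + t%:C * a.
  by rewrite rmorphB rmorph1; ring.
apply: (le_trans (cabsD_le _ _)); rewrite !cabsM !cabs_real !ger0_norm ?subr_ge0//.
have h1 : (1 - t) * cabs b <= (1 - t) * m by rewrite ler_wpM2l// subr_ge0.
have h2 : t * cabs a <= t * m by rewrite ler_wpM2l.
by move: h1 h2; move: (cabs a) (cabs b) => u v; lra.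
Qed.

(* Vanishing near a point propagates along a chain of small discs covering a
   segment. *)
Lemma identity_disc (f : C -> C) (b : C) (e : R) : hol_disc f -> cabs b < 1 -> 0 < e ->
  (forall z, cabs (z - b) < e -> f z = 0) -> forall a, cabs a < 1 -> f a = 0.
Proof.
move=> df b1 e0 fb a a1.
pose m := Num.max (cabs a) (cabs b).
have m1 : m < 1 by rewrite gt_max a1 b1.
have am : cabs a <= m by rewrite le_max lexx.
have bm : cabs b <= m by rewrite le_max lexx orbT.
clearbody m.
pose n := (Num.truncn (cabs (a - b) / ((1 - m) / 2))).+1.
have eta0 : 0 < (1 - m) / 2 by rewrite divr_gt0// subr_gt0.
have nP : cabs (a - b) / n%:R < (1 - m) / 2.
  rewrite ltr_pdivrMr// mulrC -ltr_pdivrMr//; exact: truncnS_gt.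
have n0 : 0 < n%:R :> R by rewrite ltr0n.
clearbody n.
pose p (j : nat) := b + (j%:R / n%:R)%:C * (a - b).
have pm j : (j <= n)%N -> cabs (p j) <= m.
  by move=> jn; apply: segment_disc => //; rewrite divr_ge0//= ler_pdivrMr// mul1r ler_nat.
have step j : (j <= n)%N -> exists2 e, 0 < e & forall z, cabs (z - p j) < e -> f z = 0.
  elim: j => [_|j IH jn]; first by exists e => // z; rewrite /p mul0r mul0r addr0; exact: fb.
  have [e1 e10 e1P] := IH (ltnW jn).
  have pj := pm _ (ltnW jn).
  (* Three quarters of [1 - m] contain the step to the next centre, shorter than [(1 - m) / 2],
     together with a disc of radius [(1 - m) / 4] around it. *)
  have rr : 0 < (1 - m) * (3 / 4) < 1 - cabs (p j).
    have m1' : 0 < 1 - m by rewrite subr_gt0.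
    by rewrite mulr_gt0//=; move: (cabs (p j)) pj => u; lra.
  have [H|[e2 e20 e2P]] := isolated_or_zero (@hol_disc_ball f (p j) df) rr.
    exists ((1 - m) / 4); first by rewrite divr_gt0// subr_gt0.
    move=> z zj; apply: H.
    apply: (le_lt_trans (cabs_triangle _ (p j.+1) _)).
    have : cabs (p j.+1 - p j) < (1 - m) / 2.
      have -> : p j.+1 - p j = n%:R^-1%:C * (a - b).
        by rewrite /p -natr1 mulrDl rmorphD mul1r /=; ring.
      by rewrite cabsM cabs_real ger0_norm ?invr_ge0 ?ler0n// mulrC.
    by move: zj; move: (cabs _) (cabs _) => u v; lra.
  (* If zeros were isolated at [p j], a point at distance [s] would be a zero and not a zero at
     once. *)
  pose s := Num.min e1 e2 / 2.
  have s0 : 0 < s by rewrite divr_gt0// lt_min e10.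
  have ss : s < Num.min e1 e2 by rewrite ltr_pdivrMr// ltr_pMr ?ltr1n// lt_min e10.
  have sE : cabs (p j + s%:C - p j) = s by rewrite addrAC subrr add0r cabs_real gtr0_norm.
  move: ss; rewrite lt_min => /andP[se1 se2].
  have := e2P (p j + s%:C); rewrite sE s0 se2 => /(_ isT).
  by rewrite e1P ?eqxx// sE.
have [e3 e30 e3P] := step n (leqnn n).
have pn : p n = a by rewrite /p divff ?gt_eqF// rmorph1 mul1r addrC subrK.
by apply: e3P; rewrite pn subrr cabs0.
Qed.

Lemma isolated_zeros (f : C -> C) (a b : C) : hol_disc f -> cabs a < 1 -> f a != 0 ->
  cabs b < 1 -> exists2 e, 0 < e & forall z, 0 < cabs (z - b) < e -> f z != 0.
Proof.
move=> df a1 fa b1.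
have rr : 0 < (1 - cabs b) / 2 < 1 - cabs b.
  have b1' : 0 < 1 - cabs b by rewrite subr_gt0.
  by rewrite divr_gt0//= ltr_pdivrMr// ltr_pMr// ltr1n.
have [H|//] := isolated_or_zero (@hol_disc_ball f b df) rr.
have r0 : 0 < (1 - cabs b) / 2 by case/andP: rr.
by move: fa; rewrite (identity_disc df b1 r0 H a1) eqxx.
Qed.

(** If f - f(a) did not vanish near [a], its first nonzero term c_m (z - a)^m would have m > 0, and
    in a direction where this term points along f(a) the modulus of [f] would exceed 1 by an amount
    of order t^m. *)
Lemma max_principle (f : C -> C) (a : C) : hol_disc f ->
  (forall z, cabs z < 1 -> cabs (f z) <= 1) -> cabs a < 1 -> cabs (f a) = 1 ->
  forall z, cabs z < 1 -> f z = f a.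
Proof.
move=> df f1 a1 fa.
pose g z := f z - f a.
have dg : hol_disc g.
  by move=> z z1; apply: derivableCB; [exact: df|exact: derivableC_cst].
suff [e e0 eP] : exists2 e, 0 < e & forall z, cabs (z - a) < e -> g z = 0.
  by move=> z z1; apply/eqP; rewrite -subr_eq0; apply/eqP;
    exact: (identity_disc dg a1 e0 eP z1).
have a1' : 0 < 1 - cabs a by rewrite subr_gt0.
pose r := (1 - cabs a) / 2.
have r0 : 0 < r by rewrite divr_gt0.
have rr : 0 < r < 1 - cabs a.
  by rewrite r0 ltr_pdivrMr// ltr_pMr// ltr1n.
have [c [c0 cP]] := local_expansion (@hol_disc_ball g a dg) rr.
have [c00|] := pselect (forall k, c k = 0); first by exists r => //; exact: c0.
move=> /existsNP[k0 /eqP ck0]; exfalso.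
have exk : exists k, c k != 0 by exists k0.
have [m cm mmin] := ex_minnP exk.
have m0 : (0 < m)%N.
  rewrite lt0n; apply/eqP => mE; have [K K0] := cP 1%N.
  move=> /(_ a); rewrite big_ord1 expr0 mulr1 subrr cabs0 divr_gt0// => /(_ isT).
  rewrite expr1 mulr0 /g subrr sub0r cabsN => H.
  by move: cm; rewrite mE -cabs_gt0 ltNge H.
have [K K0 KP] := cP m.+1.
have Ncm : 0 < cabs (c m) by rewrite cabs_gt0.
have K1 : 0 < K + 1 by rewrite ltr_wpDl.
(* With this root, [c m * w ^+ m] is [f a] times the positive number [cabs (c m)], and [w] is
   unimodular because [f a] is. *)
pose w := m.-root (f a * (cabs (c m))%:C / c m).
have wm : w ^+ m = f a * (cabs (c m))%:C / c m by rewrite rootCK.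
have Nw : cabs w = 1.
  have : cabs w ^+ m = 1.
    by rewrite -cabsX wm !cabsM cabsV fa mul1r cabs_real ger0_norm ?cabs_ge0// divff// gt_eqF.
  by move=> /eqP; rewrite pexpr_eq1 ?cabs_ge0// => /eqP.
(* Small enough for [z] to stay where the expansion holds, and for [K * t] to be less than
   [cabs (c m)], so that the remainder cannot offset the gain. *)
pose t := Num.min (r / 4) (cabs (c m) / (K + 1) / 2).
have t0 : 0 < t by rewrite lt_min !divr_gt0.
have tr : t < r / 2.
  by rewrite gt_min; apply/orP; left; lra.
have tc : t < cabs (c m) / (K + 1).
  rewrite gt_min; apply/orP; right.
  by rewrite ltr_pdivrMr// ltr_pMr ?ltr1n// divr_gt0.
pose z := a + t%:C * w.
have zE : z - a = t%:C * w by rewrite /z addrAC subrr add0r.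
have Nz : cabs (z - a) = t by rewrite zE cabsM cabs_real Nw mulr1 gtr0_norm.
have z1 : cabs z < 1.
  rewrite -(subrK a z); apply: (le_lt_trans (cabsD_le _ _)); rewrite Nz.
  by move: tr; rewrite /r; move: (cabs a) a1' => u; lra.
have := KP z; rewrite Nz => /(_ tr); rewrite big_ord_recr /= big1 ?add0r; last first.
  move=> k _; suff -> : c k = 0 by rewrite mul0r.
  apply/eqP; apply: contraT => ck; have := mmin _ ck.
  by rewrite leqNgt ltn_ord.
rewrite zE exprMn mulrCA wm => H.
have E : f a + (t%:C ^+ m * (c m * (f a * (cabs (c m))%:C / c m))) =
    f a * (1 + t ^+ m * cabs (c m))%:C.
  by rewrite rmorphD rmorphM rmorphXn rmorph1; field.
have : cabs (f a * (1 + t ^+ m * cabs (c m))%:C) <= 1 + K * t ^+ m.+1.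
  rewrite -E; set X := _ * (_ * _) in H *.
  have -> : f a + X = f z - (g z - X) by rewrite /g; ring.
  by apply: (le_trans (cabsB_le _ _)); rewrite lerD// f1.
have tm : 0 < t ^+ m by rewrite exprn_gt0.
rewrite cabsM fa mul1r cabs_real ger0_norm; last first.
  by rewrite addr_ge0// mulr_ge0 ?cabs_ge0// ltW.
rewrite lerD2l exprS mulrA [leRHS]mulrC ler_pM2l// leNgt => /negP; apply.
move: tc; rewrite ltr_pdivlMr//; apply: le_lt_trans.
by rewrite mulrDr mulr1 mulrC lerDl ltW.
Qed.

(** Riemann's device: (z - a)^2 v/u is differentiable at [a] too, being O(|z - a|^2) there, so it
    has a Taylor expansion. Its first two coefficients vanish, and division by (z - a)^2 yields a
    first-order expansion of v/u around [a], whether or not [u] vanishes at [a]. *)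
Lemma quotient_expansion (u v : C -> C) (a b : C) : hol_disc u -> hol_disc v ->
  cabs b < 1 -> u b != 0 ->
  (forall z, cabs z < 1 -> u z != 0 -> cabs (v z / u z) <= 1) -> cabs a < 1 ->
  exists c D K d, [/\ 0 < d, 0 <= K & forall z, 0 < cabs (z - a) < d ->
    [/\ cabs z < 1, u z != 0 & cabs (v z / u z - c - D * (z - a)) <= K * cabs (z - a) ^+ 2]].
Proof.
move=> du dv b1 ub q1 a1.
have [d1 d10 d1P] := isolated_zeros du b1 ub a1.
have a1' : 0 < 1 - cabs a by rewrite subr_gt0.
pose d := Num.min d1 (1 - cabs a).
have d0 : 0 < d by rewrite lt_min d10.
have dP z : cabs (z - a) < d -> cabs z < 1.
  rewrite lt_min => /andP[_ h]; rewrite -(subrK a z).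
  by apply: (le_lt_trans (cabsD_le _ _)); rewrite -ltrBrDr.
have uP z : 0 < cabs (z - a) < d -> u z != 0.
  by rewrite lt_min => /and3P[z0 zd _]; apply: d1P; rewrite z0.
clearbody d.
(* At [a] the square vanishes, so the value that division by zero gives to the quotient is
   irrelevant. *)
pose h z := (z - a) ^+ 2 * (v z * (u z)^-1).
have Nh z : cabs (z - a) < d -> cabs (h z) <= cabs (z - a) ^+ 2.
  move=> zd; have [->|za] := eqVneq z a.
    by rewrite /h subrr expr0n mul0r cabs0 expr0n.
  rewrite /h cabsM cabsX ler_piMr ?exprn_ge0 ?cabs_ge0//; apply: q1; first exact: dP.
  by apply: uP; rewrite cabs_gt0 subr_eq0 za.
have dh z : cabs (z - a) < d -> derivable h z 1.
  move=> zd; have [->|za] := eqVneq z a.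
    apply/derivableCP; exists 0 => e e0; exists (Num.min d e); first by rewrite lt_min d0.
    move=> w; rewrite lt_min => /andP[wd we].
    have -> : h w - h a - 0 * (w - a) = h w by rewrite /h subrr expr0n !mul0r !subr0.
    by apply: (le_trans (Nh _ wd)); rewrite expr2 ler_wpM2r ?cabs_ge0// ltW.
  apply: derivableCM.
    apply: derivableCX; apply: derivableCB; first exact: derivableC_id.
    exact: derivableC_cst.
  apply: derivableCM; first by apply: dv; exact: dP.
  apply: derivableCV; last by apply: du; exact: dP.
  by apply: uP; rewrite cabs_gt0 subr_eq0 za.
have rr : 0 < d / 2 < d by rewrite divr_gt0//= ltr_pdivrMr// ltr_pMr// ltr1n.
have [c [_ cP]] := local_expansion dh rr.
have d40 : 0 < d / 2 / 2 by rewrite !divr_gt0.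
have d4d : d / 2 / 2 < d by lra.
have c00 : c 0%N = 0.
  have [K K0 /(_ a)] := cP 1%N; rewrite big_ord1 subrr cabs0 expr1 mulr0 expr0 mulr1.
  move=> /(_ d40); rewrite /h subrr expr0n mul0r sub0r cabsN => H.
  by apply/eqP; rewrite -cabs_eq0 eq_le H cabs_ge0.
have c10 : c 1%N = 0.
  have [K K0 KP] := cP 2%N.
  apply/eqP; rewrite -cabs_eq0 eq_le cabs_ge0 andbT.
  apply: (le_of_small d40 (addr_ge0 K0 ler01)) => s /andP[s0 sd].
  have sE : a + s%:C - a = s%:C by rewrite addrAC subrr add0r.
  have Ns : cabs (s%:C : C) = s by rewrite cabs_real gtr0_norm.
  have := KP (a + s%:C); have := Nh (a + s%:C); rewrite sE Ns.
  rewrite !big_ord_recr big_ord0 /= c00 mul0r !add0r expr1 => h1 h2.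
  have {}h1 := h1 (lt_trans sd d4d); have {}h2 := h2 sd.
  rewrite -(ler_pM2r s0) mulrDl mul1r.
  have -> : cabs (c 1%N) * s = cabs (c 1%N * s%:C) by rewrite cabsM Ns.
  have -> : c 1%N * s%:C = h (a + s%:C) - (h (a + s%:C) - c 1%N * s%:C) by ring.
  apply: (le_trans (cabsB_le _ _)); rewrite mulrDl -expr2 addrC.
  by rewrite -mulrA -expr2 lerD.
(* Order 4, since division by (z - a)^2 must leave a quadratic remainder. *)
have [K K0 KP] := cP 4%N.
exists (c 2), (c 3), K, (d / 2 / 2); split=> // z /andP[z0 zd].
have zd' := lt_trans zd d4d.
have uz : u z != 0 by apply: uP; rewrite z0.
split=> //; first exact: dP.
have w0 : z - a != 0 by rewrite -cabs_gt0.
have := KP z zd; rewrite !big_ord_recr big_ord0 /= c00 c10 !mul0r !add0r.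
have -> : h z - (c 2 * (z - a) ^+ 2 + c 3 * (z - a) ^+ 3) =
    (z - a) ^+ 2 * (v z / u z - c 2 - c 3 * (z - a)).
  by rewrite /h; ring.
rewrite cabsM cabsX [4%N](_ : _ = (2 + 2)%N)// exprD mulrCA ler_pM2l//.
by rewrite exprn_gt0.
Qed.

(** [phi a] is the constant term of the expansion of the quotient at [a], chosen at each point
    separately. Where [u] does not vanish, continuity identifies it with the quotient. As [u] has no
    zero near [a] except possibly [a], the expansion at [a] then states that [phi] is differentiable
    there, and the bound 1 passes to the limit. *)
Lemma removable_quotient (u v : C -> C) (b : C) : hol_disc u -> hol_disc v ->
  cabs b < 1 -> u b != 0 ->
  (forall z, cabs z < 1 -> u z != 0 -> cabs (v z / u z) <= 1) ->
  exists phi : C -> C, [/\ hol_disc phi, forall z, cabs z < 1 -> cabs (phi z) <= 1 &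
    forall z, cabs z < 1 -> u z != 0 -> phi z = v z / u z].
Proof.
move=> du dv b1 ub q1.
have /choice[phi phiP] : forall a, exists c, cabs a < 1 ->
    exists D K d, [/\ 0 < d, 0 <= K & forall z, 0 < cabs (z - a) < d ->
    [/\ cabs z < 1, u z != 0 & cabs (v z / u z - c - D * (z - a)) <= K * cabs (z - a) ^+ 2]].
  move=> a; have [a1|a1] := boolP (cabs a < 1); last by exists 0.
  by have [c H] := quotient_expansion du dv b1 ub q1 a1; exists c.
have sE a (s : R) : a + s%:C - a = s%:C by rewrite addrAC subrr add0r.
have near a (s : R) : 0 < s -> cabs (a + s%:C - a) = s.
  by move=> s0; rewrite sE cabs_real gtr0_norm.
have phiE z : cabs z < 1 -> u z != 0 -> phi z = v z / u z.
  move=> z1 uz; have [D [K [d [d0 K0 H]]]] := phiP z z1.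
  have dq : derivable (fun w => v w / u w) z 1.
    by apply: derivableCM; [exact: dv|apply: derivableCV => //; exact: du].
  have [E /(_ 1 ltr01)[r r0 rP]] := (derivableCP _ _).1 dq.
  apply/eqP; rewrite eq_sym -subr_eq0 -cabs_eq0 eq_le cabs_ge0 andbT.
  pose d' := Num.min 1 (Num.min d r).
  have d'0 : 0 < d' by rewrite !lt_min ltr01 d0.
  have L0 : 0 <= (1 + cabs E) + (cabs D + K) by rewrite !addr_ge0 ?cabs_ge0.
  apply: (le_of_small d'0 L0) => s /andP[s0]; rewrite !lt_min => /and3P[s1 sd sr].
  have := H (z + s%:C); have := rP (z + s%:C); rewrite near// s0 sd sE mul1r.
  move=> /(_ sr) h1 /(_ isT)[_ _ h2].
  have Ns : cabs (s%:C : C) = s by rewrite cabs_real gtr0_norm.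
  set Q := v (z + s%:C) / u (z + s%:C) in h1 h2.
  have -> : v z / u z - phi z =
     (Q - phi z - D * s%:C) + D * s%:C - ((Q - v z / u z - E * s%:C) + E * s%:C).
    by ring.
  apply: (le_trans (cabsB_le _ _)); rewrite add0r addrC mulrDl; apply: lerD.
    by apply: (le_trans (cabsD_le _ _)); rewrite cabsM Ns mulrDl mul1r lerD2r.
  apply: (le_trans (cabsD_le _ _)); rewrite cabsM Ns mulrDl addrC lerD2l.
  apply: (le_trans h2); rewrite expr2 mulrA ler_piMr ?mulr_ge0 ?(ltW s0)//.
  exact: ltW.
exists phi; split; [move=> a a1|move=> a a1|exact: phiE].
  have [D [K [d [d0 K0 H]]]] := phiP a a1.
  apply/derivableCP; exists D => e e0.
  have K1 : 0 < K + 1 by rewrite ltr_wpDl.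
  exists (Num.min d (e / (K + 1))); first by rewrite lt_min d0 divr_gt0.
  move=> w; rewrite lt_min => /andP[wd we].
  have [->|wa] := eqVneq w a; first by rewrite !subrr mulr0 subr0 cabs0 mulr0.
  have w0 : 0 < cabs (w - a) by rewrite cabs_gt0 subr_eq0.
  have := H w; rewrite w0 wd => /(_ isT)[w1 uw h].
  rewrite (phiE w)//; apply: (le_trans h); rewrite expr2 mulrA ler_pM2r//.
  move: we; rewrite ltr_pdivlMr// => /ltW; apply: le_trans.
  by rewrite mulrDr mulr1 mulrC lerDl ltW.
have [D [K [d [d0 K0 H]]]] := phiP a a1.
pose d' := Num.min 1 d.
have d'0 : 0 < d' by rewrite !lt_min ltr01 d0.
have L0 : 0 <= cabs D + K by rewrite !addr_ge0 ?cabs_ge0.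
apply: (le_of_small d'0 L0) => s /andP[s0]; rewrite !lt_min => /andP[s1 sd].
have := H (a + s%:C); rewrite near// s0 sd sE => /(_ isT)[as1 uas h2].
have Ns : cabs (s%:C : C) = s by rewrite cabs_real gtr0_norm.
have h1 := q1 _ as1 uas.
set Q := v (a + s%:C) / u (a + s%:C) in h1 h2.
have -> : phi a = Q - ((Q - phi a - D * s%:C) + D * s%:C) by ring.
apply: (le_trans (cabsB_le _ _)); apply: lerD => //.
apply: (le_trans (cabsD_le _ _)); rewrite cabsM Ns mulrDl addrC lerD2l.
apply: (le_trans h2); rewrite expr2 mulrA ler_piMr ?mulr_ge0 ?(ltW s0)//.
exact: ltW.
Qed.

End Local.

(** * Normed series and evaluation in Hol(D) *)

Section Series.
Variable R : realType.
Local Notation C := R[i].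

Lemma rnormE (V : normedModType C) (x : V) : `|x| = (rnorm x)%:C.
Proof. by rewrite /rnorm RRe_real// ger0_real. Qed.
Lemma rnorm_ge0 (V : normedModType C) (x : V) : 0 <= rnorm x.
Proof. by rewrite -lecR -rnormE normr_ge0. Qed.
Lemma rnormZ (V : normedModType C) (c : C) (x : V) : rnorm (c *: x) = cabs c * rnorm x.
Proof. by apply: complexI; rewrite -rnormE normrZ normr_cabs rnormE rmorphM. Qed.

Lemma sum_geometric_le (q : R) m n : 0 <= q < 1 ->
  \sum_(m <= k < n) q ^+ k <= q ^+ m / (1 - q).
Proof.
move=> /andP[q0 q1]; have q10 : 0 < 1 - q by rewrite subr_gt0.
have [nm|/ltnW mn] := leqP n m.
  by rewrite big_geq// divr_ge0 ?exprn_ge0// ltW.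
rewrite ler_pdivlMr//.
have -> : (\sum_(m <= k < n) q ^+ k) * (1 - q) = q ^+ m - q ^+ n.
  rewrite mulr_suml (telescope_sumr_eq (fun k => - q ^+ k))//.
    by rewrite opprK addrC.
  by move=> k _; rewrite exprS; ring.
by rewrite lerBlDr lerDl exprn_ge0.
Qed.

Lemma normed_series_cvg (V : completeNormedModType C) (u : nat -> V) (M q : R) (k0 : nat) :
  0 <= M -> 0 <= q < 1 -> (forall k, (k0 <= k)%N -> rnorm (u k) <= M * q ^+ k) ->
  cvg (series u @ \oo).
Proof.
move=> M0 q01 uM; apply: cauchy_cvg; apply/cauchy_seriesP => _ /gt0_complexP[e e0 ->].
have /andP[q0 q1] := q01.
have q10 : 0 < 1 - q by rewrite subr_gt0.
have cq : (fun n => M / (1 - q) * q ^+ n) @ \oo --> M / (1 - q) * 0.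
  by apply: cvgM; [exact: cvg_cst|apply: cvg_expr; rewrite ger0_norm].
rewrite mulr0 in cq.
move/cvgrPdist_lt : cq => /(_ _ e0) [n0 _ n0P].
exists ([set n | (maxn n0 k0 <= n)%N], setT) => /=.
  by split; [exists (maxn n0 k0)|exact: filterT].
move=> [m n] [/= mP _].
have kk : (k0 <= m)%N by apply: leq_trans mP; exact: leq_maxr.
have nn : (n0 <= m)%N by apply: leq_trans mP; exact: leq_maxl.
apply: le_lt_trans (ler_norm_sum _ _ _) _.
have -> : \sum_(m <= k < n) `|u k| = (\sum_(m <= k < n) rnorm (u k))%:C.
  by rewrite rmorph_sum; apply: eq_bigr => k _; rewrite rnormE.
rewrite ltcR; apply: (@le_lt_trans _ _ (M / (1 - q) * q ^+ m)).
  rewrite -mulrA [_^-1 * _]mulrC.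
  apply: (@le_trans _ _ (M * \sum_(m <= k < n) q ^+ k)).
    rewrite mulr_sumr; apply: ler_sum_nat => k /andP[mk _].
    by apply: uM; exact: leq_trans mk.
  by rewrite ler_wpM2l// sum_geometric_le.
have := n0P m nn; rewrite /= sub0r normrN ger0_norm//.
by rewrite mulr_ge0 ?exprn_ge0// divr_ge0// ltW.
Qed.

Lemma limn_esup_lt (u : nat -> \bar R) (x : \bar R) : (limn_esup u < x)%E ->
  exists n0, forall n, (n0 <= n)%N -> (u n < x)%E.
Proof.
move=> /ereal_inf_lt[_ [A [n0 _ n0A] <-] Ax]; exists n0 => n nn.
apply: le_lt_trans Ax; apply: ereal_sup_ubound; exists n => //.
exact: n0A.
Qed.

Lemma discP (z : C) : disc z <-> cabs z < 1.
Proof. by rewrite /disc /= normr_cabs ltcR. Qed.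

Lemma hol_derivable (h : hol R) : hol_disc h.
Proof. by move=> z /discP z1; have /asboolP[dh _] := hol_funP h; exact: dh. Qed.

Lemma hol_eq (f g : hol R) : (forall z, cabs z < 1 -> f z = g z) -> f = g.
Proof.
move=> fg; apply: val_inj; apply/funext => z /=.
have [/discP/fg//|nz] := pselect (disc z).
have /asboolP[_ f0] := hol_funP f; have /asboolP[_ g0] := hol_funP g.
by rewrite f0// g0.
Qed.

Lemma hol_extend (f : C -> C) : hol_disc f ->
  exists h : hol R, forall z, cabs z < 1 -> h z = f z.
Proof.
move=> df; pose g z := if cabs z < 1 then f z else 0.
have gP : g \in @hol_pred R.
  apply/asboolP; split => z; last first.
    by move=> /discP/negP zn; rewrite /g (negPf zn).
  move=> /discP z1; apply: (@derivableC_near _ f g z (1 - cabs z)).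
  - by rewrite subr_gt0.
  - move=> w wz; rewrite /g ifT// -(subrK z w).
    by apply: (le_lt_trans (cabsD_le _ _)); rewrite -ltrBrDr.
  - exact: df.
by exists (Hol gP) => z z1; rewrite /= /g z1.
Qed.

(** A singleton is compact, and uniform convergence on it is convergence at the point. *)
Lemma hol_eval_continuous (z : C) : cabs z < 1 ->
  forall h : hol R, (fun g : hol R => g z) @ h --> h z.
Proof.
move=> z1 h.
have Hf : (@hol_fun R : hol R -> {family @compact_in_disc R, C -> C}) @ h -->
    (@hol_fun R h : {family @compact_in_disc R, C -> C}).
  exact: (@initial_continuous _ _
    (@hol_fun R : hol R -> {family @compact_in_disc R, C -> C}) h).
have cz : compact_in_disc [set z].
  by split; [exact: compact_set1|move=> _ ->; exact/discP].
have FF : Filter ((@hol_fun R : hol R -> {family @compact_in_disc R, C -> C}) @ h).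
  apply: (@fmap_filter _ _ _ (nbhs h) (nbhs_filter h)).
have := (@fam_cvgP _ _ _ _ _ FF).1 Hf _ cz.
by rewrite uniform_set1.
Qed.

End Series.

(** * Power series in X *)

Section Space.
Variable R : realType.
Local Notation C := R[i].

Lemma cvgC_le (T : Type) (F : set_system T) (FF : ProperFilter F) (f : T -> C)
    (l : C) (B : R) :
  f @ F --> l -> (\forall x \near F, cabs (f x) <= B) -> cabs l <= B.
Proof.
move=> fl fB; apply/ler_addgt0Pl => e e0.
have fe := (@cvgC_cabsP R T F (@filter_filter _ F FF) f l).1 fl e e0.
have [x [h1 h2]] := filter_ex (filterI fB fe).
have -> : l = f x - (f x - l) by ring.
by apply: (le_trans (cabsB_le _ _)); rewrite addrC lerD// ltW.
Qed.

Lemma cvgC_exp (w : C) : cabs w < 1 -> (fun n => w ^+ n) @ \oo --> (0 : C).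
Proof.
move=> w1; apply/cvgC_cabsP => e e0.
have /cvgrPdist_lt/(_ _ e0) : (fun n => cabs w ^+ n) @ \oo --> (0 : R).
  by apply: cvg_expr; rewrite ger0_norm ?cabs_ge0.
apply: filterS => n; rewrite sub0r normrN ger0_norm ?exprn_ge0 ?cabs_ge0//.
by rewrite subr0 cabsX.
Qed.

Lemma cvgC_geometric (w : C) : cabs w < 1 ->
  (fun n => \sum_(j < n) w ^+ j) @ \oo --> (1 - w)^-1.
Proof.
move=> w1; have w0 : 1 - w != 0.
  by rewrite subr_eq0; apply: contraTneq w1 => <-; rewrite cabs1 ltxx.
have E n : \sum_(j < n) w ^+ j = (1 - w ^+ n) * (1 - w)^-1.
  by rewrite -[1 - w ^+ n]opprB subrX1; field.
have -> : (fun n => \sum_(j < n) w ^+ j) = fun n => (1 - w ^+ n) * (1 - w)^-1.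
  by apply/funext => n; exact: E.
have c1 (x : C) : (fun _ : nat => x) @ \oo --> x by exact: cvgC_cst.
have H1 : (fun n => 1 - w ^+ n) @ \oo --> (1 - 0 : C).
  exact: (@cvgCB R nat \oo _ (fun=> 1) (fun n => w ^+ n) 1 0 (c1 1) (cvgC_exp w1)).
have := @cvgCM R nat \oo _ (fun n => 1 - w ^+ n) _ (1 - 0) _ H1 (c1 (1 - w)^-1).
have -> : (1 - 0) * (1 - w)^-1 = (1 - w)^-1 by rewrite subr0 mul1r.
by move=> H2; exact: H2.
Qed.

Variables (X : completeNormedModType C).

Lemma lin_evalD (L : {linear X -> hol R}) f g z : L (f + g) z = L f z + L g z.
Proof. by rewrite linearD. Qed.
Lemma lin_evalB (L : {linear X -> hol R}) f g z : L (f - g) z = L f z - L g z.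
Proof. by rewrite linearB. Qed.
Lemma lin_evalZ (L : {linear X -> hol R}) c f z : L (c *: f) z = c * L f z.
Proof. by rewrite linearZ. Qed.

Lemma lin_eval_sum (L : {linear X -> hol R}) (n : nat) (c : nat -> C) (e : nat -> X) z :
  L (\sum_(j < n) c j *: e j) z = \sum_(j < n) c j * L (e j) z.
Proof.
elim: n => [|n IH]; first by rewrite !big_ord0 linear0.
by rewrite !big_ord_recr /= lin_evalD IH lin_evalZ.
Qed.

Lemma lin_eval_continuous (L : {linear X -> hol R}) z : continuous L -> cabs z < 1 ->
  forall f : X, (fun g : X => L g z) @ f --> L f z.
Proof.
move=> cL z1 f; have := hol_eval_continuous z1 (h := L f).
exact: (cvg_comp _ _ (cL f)).
Qed.

Variables (inc : {linear X -> hol R}) (hX : banach_hol_space inc).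

Lemma monomials : exists e : nat -> X, forall n, is_polynomial (inc (e n)) 'X^n.
Proof.
have /choice[e eP] : forall n : nat, exists f, is_polynomial (inc f) 'X^n.
  by move=> n; exact: polynomial_mem hX 'X^n.
by exists e.
Qed.

Variables (e : nat -> X).
Hypothesis eP : forall n, is_polynomial (inc (e n)) 'X^n.

Lemma inc_monomial n z : cabs z < 1 -> inc (e n) z = z ^+ n.
Proof. by move=> /discP /(eP n) ->; rewrite hornerXn. Qed.

Lemma monomial_growth (s : R) : 1 < s ->
  exists n0, forall n, (n0 <= n)%N -> rnorm (e n) <= s ^+ n.
Proof.
move=> s1; have s0 : 0 < s by exact: lt_trans s1.
have H : (limn_esup (fun n => (rnorm (e n) `^ (n%:R^-1))%:E) < s%:E)%E.
  by apply: (le_lt_trans (monomial_limsup hX eP)); rewrite lte_fin.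
(* The successor excludes [n = 0], where the exponent [n%:R^-1] is 0 and the root does not give the
   norm back. *)
have [n0 n0P] := limn_esup_lt H; exists n0.+1 => n nn.
have := n0P n (ltnW nn); rewrite lte_fin => h.
have n_gt0 : (0 < n)%N by apply: leq_trans nn.
have nR : n%:R != 0 :> R by rewrite pnatr_eq0 -lt0n.
have -> : rnorm (e n) = (rnorm (e n) `^ n%:R^-1) ^+ n.
  rewrite -powR_mulrn ?powR_ge0// -powRrM mulVf// powRr1//.
  exact: rnorm_ge0.
by rewrite lerXn2r ?nnegrE ?powR_ge0 ?(ltW s0)// ltW.
Qed.

(** The norms of the monomials grow more slowly than [s ^+ n] for every [s > 1], so geometric decay
    of the coefficients makes the series converge absolutely in X. Quantifying over [L] gives both
    uses of the sum: [inc] identifies it as a function and [T] computes its image. *)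
Lemma power_series_mem (k : nat) (c : nat -> C) (M q : R) :
  0 <= M -> 0 <= q < 1 -> (forall j, cabs (c j) <= M * q ^+ j) ->
  exists f : X, forall (L : {linear X -> hol R}) z, continuous L -> cabs z < 1 ->
    (fun n => \sum_(j < n) c j * L (e (k + j)) z) @ \oo --> L f z.
Proof.
move=> M0 /andP[q0 q1] cM.
have q10 : 0 < 1 + q by rewrite ltr_pwDl.
(* For [q < 1] this gives both [1 < s] and [q * s < 1]. *)
pose s := 2 / (1 + q).
have s1 : 1 < s by rewrite /s ltr_pdivlMr// mul1r; lra.
have s0 : 0 < s by exact: lt_trans s1.
have qs : 0 <= q * s < 1.
  rewrite mulr_ge0 ?(ltW s0)//= /s mulrA ltr_pdivrMr// mul1r; lra.
clearbody s.
have [n0 n0P] := monomial_growth s1.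
pose u j := c j *: e (k + j).
have uM j : (n0 <= j)%N -> rnorm (u j) <= (M * s ^+ k) * (q * s) ^+ j.
  move=> nj; rewrite /u rnormZ.
  have -> : M * s ^+ k * (q * s) ^+ j = (M * q ^+ j) * s ^+ (k + j).
    by rewrite exprMn exprD; ring.
  apply: ler_pM; rewrite ?cabs_ge0 ?rnorm_ge0//.
  by apply: n0P; rewrite (leq_trans nj)// leq_addl.
have Ms : 0 <= M * s ^+ k by rewrite mulr_ge0// exprn_ge0// ltW.
have /cvg_ex[f uf] := normed_series_cvg Ms qs uM.
exists f => L z cL z1.
have := cvg_comp _ _ uf (lin_eval_continuous cL z1 (f := f)).
apply: cvg_trans; apply: near_eq_cvg; apply: nearW => n.
rewrite /= /series /= big_mkord.
exact: (lin_eval_sum L n c (fun j => e (k + j)) z).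
Qed.

Lemma polynomialE (f : X) (p : {poly C}) : is_polynomial (inc f) p ->
  f = \sum_(i < size p) p`_i *: e i.
Proof.
move=> fp; apply: (inc_injective hX); apply: hol_eq => z z1.
rewrite (lin_eval_sum inc (size p) (fun j => p`_j) e z) fp ?horner_coef//; last exact/discP.
by apply: eq_bigr => i _; rewrite inc_monomial.
Qed.

Lemma poly_agree (F G : X -> C) :
  (forall f, F @ f --> F f) -> (forall f, G @ f --> G f) ->
  (forall f p, is_polynomial (inc f) p -> F f = G f) -> forall f, F f = G f.
Proof.
move=> cF cG FG f; apply/eqP; rewrite -subr_eq0; apply/negPn/negP => nz.
have D0 : 0 < cabs (F f - G f) by rewrite cabs_gt0.
have cD : (fun g => F g - G g) @ f --> F f - G f by exact: (cvgCB _ (cF f) (cG f)).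
have nD := (@cvgC_cabsP R _ (nbhs f) (nbhs_filter f) _ _).1 cD _ D0.
have := polynomial_dense hX.
move=> /(_ (interior [set g | cabs (F g - G g - (F f - G f)) < cabs (F f - G f)])).
case.
- by exists f.
- exact: open_interior.
move=> g [/interior_subset /= h [p /FG gE]]; move: h.
by rewrite gE subrr sub0r cabsN ltxx.
Qed.

(** The geometric series of the kernel converges in X. The second part, meant for [T], sums it term
    by term under the bound 1 on the images of the monomials; it does not depend on [k]. *)
Lemma cauchy_kernel_mem (a : C) (k : nat) : cabs a < 1 ->
  exists f : X, (forall z, cabs z < 1 -> inc f z = z ^+ k / (1 - a^* * z)) /\
    forall (L : {linear X -> hol R}) z, continuous L -> cabs z < 1 ->
      (forall j, cabs (L (e j) z) <= 1) -> cabs (L f z) <= (1 - cabs a)^-1.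
Proof.
move=> a1; have Na : cabs (a^*) = cabs a.
  by rewrite !cabs.unlock; case: (a) => x y /=; rewrite sqrrN.
have q01 : 0 <= cabs a < 1 by rewrite cabs_ge0.
have cM j : cabs (a^* ^+ j) <= 1 * cabs a ^+ j by rewrite cabsX Na mul1r.
have [f fP] := power_series_mem k ler01 q01 cM.
exists f; split=> [z z1|L z cL z1 L1].
  have az : cabs (a^* * z) < 1.
    by rewrite cabsM Na mulr_ilt1 ?cabs_ge0.
  apply: (@cvgC_unique R _ \oo _ _ _ _ (fP inc z (inc_continuous hX) z1)).
  have -> : (fun n => \sum_(j < n) a^* ^+ j * inc (e (k + j)) z) =
      (fun n => z ^+ k * \sum_(j < n) (a^* * z) ^+ j).
    apply/funext => n; rewrite mulr_sumr; apply: eq_bigr => j _.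
    by rewrite inc_monomial// exprMn exprD mulrCA.
  by apply: (cvgCM _ _ (cvgC_geometric az)); exact: cvgC_cst.
apply: (cvgC_le _ (fP L z cL z1)); apply: nearW => n.
apply: (le_trans (cabs_sum_le _ _ _)).
apply: (@le_trans _ _ (\sum_(0 <= j < n) cabs a ^+ j)).
  rewrite big_mkord; apply: ler_sum => j _.
  by rewrite cabsM cabsX Na ler_piMr// exprn_ge0// cabs_ge0.
by have := sum_geometric_le 0 n q01; rewrite expr0 mul1r.
Qed.

End Space.

(** * Unimodular sequences and inner functions *)

Section Unimodular.
Variable R : realType.
Local Notation C := R[i].

(* First order expansion of [cabs (s v - y)] in [s]. *)
Lemma first_order_orthogonal (v y : C) : cabs y = 1 -> cabs v <= 2 ->
  (forall j : nat, let s : R := j.+2%:R^-1 in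
    `|cabs (s%:C * v - y) - 1| <= 4 * s ^+ 2) ->
  complex.Re y * complex.Re v + complex.Im y * complex.Im v = 0.
Proof.
move=> y1 v2 H; set P := (X in X = 0).
have Ny : complex.Re y ^+ 2 + complex.Im y ^+ 2 = 1 by rewrite -cabs_sqr y1 expr1n.
have key (j : nat) : `|P| <= 8 * j.+1%:R^-1.
  have := H j; cbv zeta; set s : R := j.+2%:R^-1 => Hs.
  have s0 : 0 < s by rewrite invr_gt0.
  have s12 : s <= 1 / 2 by rewrite /s mul1r lef_pV2 ?posrE// ler_nat.
  have sj : s <= j.+1%:R^-1 by rewrite /s lef_pV2 ?posrE// ler_nat.
  apply: (@le_trans _ _ (8 * s)); last by rewrite ler_pM2l.
  clearbody s.
  set n := cabs _ in Hs.
  (* [P] is the real part of conj(y) v, the first-order coefficient up to the factor -2. *)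
  have nE : n ^+ 2 = s ^+ 2 * cabs v ^+ 2 - 2 * s * P + 1.
    transitivity (s ^+ 2 * cabs v ^+ 2 - 2 * s * P +
      (complex.Re y ^+ 2 + complex.Im y ^+ 2)); last by rewrite Ny.
    rewrite /n !cabs_sqr /P; case: (v) => v1 v2'; case: (y) => y1' y2' /=.
    by rewrite !mul0r subr0 addr0; ring.
  have n0 : 0 <= n by exact: cabs_ge0.
  have n2 : n <= 2.
    apply: (le_trans (cabsB_le _ _)); rewrite y1 cabsM cabs_real gtr0_norm//.
    have : s * cabs v <= 1 / 2 * 2 by apply: ler_pM; rewrite ?cabs_ge0 ?(ltW s0).
    by move: (s * cabs v) => u; lra.
  have Nv4 : cabs v ^+ 2 <= 4.
    have -> : 4 = 2 * 2 :> R by rewrite -natrM.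
    by rewrite expr2; apply: ler_pM; rewrite ?cabs_ge0.
  have Nv0 : 0 <= cabs v ^+ 2 by rewrite exprn_ge0// cabs_ge0.
  clearbody n P; move: (cabs v ^+ 2) Nv4 Nv0 nE => V V4 V0 nE.
  have h1 : `|n ^+ 2 - 1| <= 12 * s ^+ 2.
    have -> : n ^+ 2 - 1 = (n - 1) * (n + 1) by ring.
    rewrite normrM (ger0_norm (_ : 0 <= n + 1)); last by rewrite addr_ge0.
    apply: (@le_trans _ _ (4 * s ^+ 2 * 3)).
      by apply: ler_pM => //; [rewrite addr_ge0|lra].
    by rewrite le_eqVlt; apply/orP; left; apply/eqP; ring.
  have h2 : s ^+ 2 * V <= 4 * s ^+ 2 by rewrite mulrC ler_pM2r// exprn_gt0.
  have h3 : 0 <= s ^+ 2 * V by rewrite mulr_ge0// exprn_ge0// ltW.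
  (* The hypothesis and [n + 1 <= 3] contribute [12 * s ^+ 2], the quadratic term at most
     [4 * s ^+ 2]; half of their sum bounds the modulus of [s * P]. *)
  have h4 : `|s * P| <= s * (8 * s).
    have -> : s * (8 * s) = 8 * s ^+ 2 by ring.
    move: h1; rewrite nE addrK !ler_norml => /andP[]; rewrite -mulrA.
    move: (s * P) (s ^+ 2 * V) (s ^+ 2) h2 h3 => x1 x2 x3 h2 h3 g1 g2.
    by apply/andP; split; lra.
  by move: h4; rewrite normrM gtr0_norm// ler_pM2l.
have cv : (fun j : nat => 8 * j.+1%:R^-1 : R) @ \oo --> (8 * 0 : R).
  by apply: cvgM; [exact: cvg_cst|exact: cvg_harmonic].
rewrite mulr0 in cv.
apply/eqP; rewrite -normr_le0.
have <- : limn (fun j : nat => 8 * j.+1%:R^-1 : R) = 0 by exact: cvg_lim cv.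
apply: limr_ge; first by apply/cvg_ex; exists 0.
by apply: nearW.
Qed.

(** The two orthogonality relations say that conj(y) (x - w) has real part 0 and conj(y) (x + w)
    imaginary part 0. Thus conj(y) w is the conjugate of conj(y) x, and their product conj(y)^2 x w
    is 1. *)
Lemma unimodular_geometric (x y w : C) : cabs x = 1 -> cabs y = 1 -> cabs w = 1 ->
  (forall j : nat, let s : R := j.+2%:R^-1 in
    `|cabs (s%:C * (x - w) - y) - 1| <= 4 * s ^+ 2) ->
  (forall j : nat, let s : R := j.+2%:R^-1 in
    `|cabs (s%:C * ('i%C * (x + w)) - y) - 1| <= 4 * s ^+ 2) ->
  x * w = y ^+ 2.
Proof.
move=> x1 y1 w1 H1 H2.
have b1 : cabs (x - w) <= 2 by apply: (le_trans (cabsB_le _ _)); rewrite x1 w1.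
have b2 : cabs ('i%C * (x + w)) <= 2.
  by rewrite cabsM cabs_i mul1r; apply: (le_trans (cabsD_le _ _)); rewrite x1 w1.
have := first_order_orthogonal y1 b1 H1; have := first_order_orthogonal y1 b2 H2.
have := cabs_sqr x; have := cabs_sqr y; rewrite x1 y1 expr1n.
case: x {x1 H1 H2 b1 b2} => x1 x2; case: y {y1} => y1 y2; case: w {w1} => w1 w2 /=.
rewrite !mul0r !mul1r sub0r add0r => ny nx h1 h2.
(* [p1] and [p2] are the real and imaginary parts of conj(y) x; those of conj(y) w turn out to be
   [p1] and [- p2]. *)
pose p1 := y1 * x1 + y2 * x2; pose p2 := y1 * x2 - y2 * x1.
have q1 : y1 * w1 + y2 * w2 = p1 by move: h2; rewrite /p1; lra.
have q2 : y1 * w2 - y2 * w1 = - p2 by move: h1; rewrite /p2; lra.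
have pp : p1 ^+ 2 + p2 ^+ 2 = 1.
  have -> : p1 ^+ 2 + p2 ^+ 2 = (y1 ^+ 2 + y2 ^+ 2) * (x1 ^+ 2 + x2 ^+ 2).
    by rewrite /p1 /p2; ring.
  by rewrite -ny -nx mulr1.
have e1 : w1 = y1 * p1 + y2 * p2.
  rewrite -[LHS]mul1r ny -q1 -[p2]opprK -q2; ring.
have e2 : w2 = y2 * p1 - y1 * p2.
  rewrite -[LHS]mul1r ny -q1 -[p2]opprK -q2; ring.
have f1 : x1 = y1 * p1 - y2 * p2 by rewrite -[LHS]mul1r ny /p1 /p2; ring.
have f2 : x2 = y2 * p1 + y1 * p2 by rewrite -[LHS]mul1r ny /p1 /p2; ring.
clearbody p1 p2; rewrite e1 e2 f1 f2.
have g1 : p1 ^+ 2 = 1 - p2 ^+ 2 by move: pp; lra.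
apply/eqP; rewrite eq_complex /=; apply/andP; split; apply/eqP.
  transitivity ((y1 ^+ 2 - y2 ^+ 2) * (p1 ^+ 2 + p2 ^+ 2)); first by ring.
  by rewrite pp; ring.
transitivity (2 * y1 * y2 * (p1 ^+ 2 + p2 ^+ 2)); first by ring.
by rewrite pp; ring.
Qed.

(** This is m_k = m_0 (m_1/m_0)^k cleared of denominators, a form that also makes sense in the disc,
    where the function playing the part of m_0 may vanish. The recurrence has order two, so two
    consecutive indices are carried through the induction. *)
Lemma geometric_recurrence (m : nat -> C) : (forall k, m k != 0) ->
  (forall k, m k * m k.+2 = m k.+1 ^+ 2) ->
  forall k, m k * m 0%N ^+ k = m 1%N ^+ k * m 0%N.
Proof.
move=> m0 mr k.
suff [] : m k * m 0%N ^+ k = m 1%N ^+ k * m 0%N /\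
  m k.+1 * m 0%N ^+ k.+1 = m 1%N ^+ k.+1 * m 0%N by [].
elim: k => [|k [IH1 IH2]]; first by rewrite expr0 mulr1 mul1r !expr1.
split=> //.
have nz : m 1%N ^+ k * m 0%N != 0 by rewrite mulf_neq0// expf_neq0.
apply: (mulfI nz).
transitivity (m k * m k.+2 * (m 0%N ^+ k.+1) ^+ 2).
  by rewrite -IH1 !exprS; ring.
rewrite mr -exprMn IH2 !exprS; ring.
Qed.

End Unimodular.

(** * Inner functions and identities almost everywhere on the circle *)

Section Inner.
Variable R : realType.
Local Notation C := R[i].
Local Notation mu := (@lebesgue_measure R).

Lemma ae_and (P Q : R -> Prop) : {ae mu, forall t, P t} -> {ae mu, forall t, Q t} ->
  {ae mu, forall t, P t /\ Q t}.
Proof. by apply: filterI; exact: (ae_filter_ringOfSetsType mu). Qed.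

Lemma radial_limitM (h g : C -> C) t l m : radial_limit h t l ->
  radial_limit g t m -> radial_limit (fun z => h z * g z) t (l * m).
Proof. exact: cvgCM. Qed.
Lemma radial_limitB (h g : C -> C) t l m : radial_limit h t l ->
  radial_limit g t m -> radial_limit (fun z => h z - g z) t (l - m).
Proof. exact: cvgCB. Qed.
Lemma radial_limitX (h : C -> C) t l n : radial_limit h t l ->
  radial_limit (fun z => h z ^+ n) t (l ^+ n).
Proof. exact: cvgCX. Qed.
Lemma radial_limitV (h : C -> C) t l : l != 0 -> radial_limit h t l ->
  radial_limit (fun z => (h z)^-1) t l^-1.
Proof. exact: cvgCV. Qed.
Lemma radial_limit_cst (c : C) t : radial_limit (fun=> c) t c.
Proof. exact: cvgC_cst. Qed.

Lemma inner_radial (h : hol R) : inner h ->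
  {ae mu, forall t, t \in `[0, 2 * pi[ -> exists2 l, radial_limit h t l & cabs l = 1}.
Proof.
move=> [_]; apply: ae_sub => t H /H[l hl l1]; exists l => //.
by apply: complexI; rewrite -normr_cabs l1.
Qed.

Lemma inner_bound (h : hol R) : inner h -> forall z, cabs z < 1 -> cabs (h z) <= 1.
Proof.
move=> hi; have [[B hB] _] := hi.
apply: (@boundary_bound R h 1 B ler01 (@hol_derivable R h)).
  by move=> z z1; rewrite -lecR -normr_cabs; apply: hB; exact/discP.
apply: ae_sub (inner_radial hi) => t H /H[l hl l1]; exists l => //.
by rewrite l1.
Qed.

Lemma near_left_disc (t : R) : \forall r \near (1 : R)^'-, cabs (r%:C * cis t) < 1.
Proof.
near=> r; rewrite cabsM cabs_cis cabs_real mulr1 ger0_norm; last first.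
  by apply: ltW; near: r; exact: nbhs_left_gt.
by near: r; exact: nbhs_left_lt.
Unshelve. all: by end_near. Qed.

(** The case [M = 0] of [boundary_bound]; every identity found almost everywhere on the circle is
    carried into the disc through it. *)
Lemma boundary_zero (h : C -> C) (B : R) : hol_disc h ->
  (forall z, cabs z < 1 -> cabs (h z) <= B) ->
  {ae mu, forall t, t \in `[0, 2 * pi[ -> radial_limit h t 0} ->
  forall z, cabs z < 1 -> h z = 0.
Proof.
move=> dh hB h0 z z1; apply/eqP; rewrite -cabs_eq0 eq_le cabs_ge0 andbT.
apply: (boundary_bound (lexx 0) dh hB _ z1).
by apply: ae_sub h0 => t H /H h0; exists 0 => //; rewrite cabs0.
Qed.

Lemma inner_neq0 (h : hol R) : inner h -> exists2 b, cabs b < 1 & h b != 0.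
Proof.
move=> hi; apply: contrapT => H.
have h0 z : cabs z < 1 -> h z = 0.
  by move=> z1; apply/eqP/negPn/negP => hz; apply: H; exists z.
(* This is how it is seen that the circle is not a null set: if [h] were 0, having unimodular radial
   limits would be contradictory at every [t], so that anything holds almost everywhere, in
   particular that the constant 1 has radial limit 0. *)
suff : (1 : C) = 0 by move/eqP; rewrite oner_eq0.
have d1 : hol_disc (fun=> 1 : C) by move=> z _; exact: derivableC_cst.
apply: (@boundary_zero (fun=> 1) 1 d1 _ _ 0); last by rewrite cabs0.
  by move=> z _; rewrite cabs1.
apply: ae_sub (inner_radial hi) => t Ht /Ht[l hl l1]; exfalso.
have c0 : radial_limit h t 0.
  apply/cvgC_cabsP => e e0; have := near_left_disc t.
  by apply: filterS => r /h0 ->; rewrite subrr cabs0.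
have E := cvgC_unique _ hl c0.
by move: l1; rewrite E cabs0 => /eqP; rewrite eq_sym oner_eq0.
Qed.

End Inner.

(** * The symbol of the operator *)

Section Operator.
Variable R : realType.
Local Notation C := R[i].
Local Notation mu := (@lebesgue_measure R).
Variables (X : completeNormedModType C) (inc : {linear X -> hol R}).
Hypothesis hX : banach_hol_space inc.
Variable (T : {linear X -> hol R}).
Hypothesis T_continuous : continuous T.
Hypothesis T_blaschke : forall f : X, finite_blaschke (inc f) -> inner (T f).
Variables (e : nat -> X).
Hypothesis eP : forall n, is_polynomial (inc (e n)) 'X^n.

Local Notation u k := (T (e k)).

Lemma prod_factor_zero k (z : C) :
  (-1) ^+ k * \prod_(b <- nseq k (0 : C)) ((b - z) / (1 - b^* * z)) = z ^+ k.
Proof.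
elim: k => [|k IH]; first by rewrite big_nil mulr1.
have -> : nseq k.+1 (0 : C) = 0 :: nseq k 0 by [].
rewrite big_cons [RHS]exprS -IH conjC0 mul0r subr0 divr1 sub0r exprS.
by ring.
Qed.

Lemma inner_monomial k : inner (u k).
Proof.
apply: T_blaschke; exists ((-1) ^+ k), (nseq k 0); split.
- by apply/eqP; rewrite normrX normrN normr1 expr1n.
- by move=> b /nseqP[-> _]; apply/discP; rewrite cabs0.
- by move=> z /discP z1; rewrite (inc_monomial eP)// prod_factor_zero.
Qed.

Lemma cabs_conj (a : C) : cabs (a^*) = cabs a.
Proof. by apply: complexI; rewrite -!normr_cabs norm_conjC. Qed.

Lemma denominator_neq0 (a z : C) : cabs a < 1 -> cabs z < 1 -> 1 - a^* * z != 0.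
Proof.
move=> a1 z1; rewrite subr_eq0; apply/eqP => E.
have : cabs (a^* * z) < 1 by rewrite cabsM cabs_conj mulr_ilt1 ?cabs_ge0.
by rewrite -E cabs1 ltxx.
Qed.

(** [f] is the product z^k (a - z)/(1 - conj(a) z). Its remainder beyond first order in [a] is
    written exactly with monomials and kernels in X, so that [T] can be applied to it and bounded
    pointwise. *)
Lemma blaschke_image (a : C) k : cabs a <= 1 / 2 ->
  exists2 f : X, inner (T f) & forall z, cabs z < 1 ->
    cabs (T f z - (a * u k z - u k.+1 z - a^* * u k.+2 z)) <= 4 * cabs a ^+ 2.
Proof.
move=> a12; have a1 : cabs a < 1 by apply: (le_lt_trans a12); lra.
have /choice[G GP] := fun j => cauchy_kernel_mem hX eP j a1.
(* [G j] is z^j / (1 - a^* z), so [f] is z^k (a - z) / (1 - a^* z). *)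
pose f := a *: G k - G k.+1.
have inc_f z : cabs z < 1 -> inc f z = z ^+ k * ((a - z) / (1 - a^* * z)).
  move=> z1; rewrite /f lin_evalB lin_evalZ.
  rewrite !(proj1 (GP _))//; have := denominator_neq0 a1 z1.
  by move: (1 - _) => w w0; rewrite exprS; field.
exists f.
  apply: T_blaschke; exists ((-1) ^+ k), (a :: nseq k 0); split.
  - by apply/eqP; rewrite normrX normrN normr1 expr1n.
  - move=> b; rewrite inE => /predU1P[->|/nseqP[-> _]]; apply/discP => //.
    by rewrite cabs0.
  - move=> z /discP z1; rewrite inc_f// -(prod_factor_zero k z) big_cons.
    by ring.
have fE : f = a *: e k - e k.+1 - a^* *: e k.+2 +
    ((a * a^*) *: e k.+1 + (a * a^* ^+ 2) *: G k.+2 - (a^* ^+ 2) *: G k.+3).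
  apply: (inc_injective hX); apply: hol_eq => z z1; rewrite inc_f//.
  rewrite !(lin_evalB, lin_evalD, lin_evalZ).
  rewrite !(inc_monomial eP)// !(proj1 (GP _))//.
  have := denominator_neq0 a1 z1; rewrite !exprS expr0.
  by move: (z ^+ k) => zk; move: a^* => b w0; field.
move=> z z1; have L1 j : cabs (T (e j) z) <= 1 by exact: (inner_bound (inner_monomial j) z1).
have GT j : cabs (T (G j) z) <= 2.
  apply: (le_trans (proj2 (GP j) T z T_continuous z1 L1)).
  have -> : 2 = (1 / 2)^-1 :> R by field.
  by rewrite lef_pV2 ?posrE ?subr_gt0//; lra.
rewrite fE !(lin_evalB, lin_evalD, lin_evalZ).
rewrite [X in cabs X](_ : _ = (a * a^*) * u k.+1 z + (a * a^* ^+ 2) * T (G k.+2) z -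
  a^* ^+ 2 * T (G k.+3) z); last by ring.
apply: (le_trans (cabsB_le _ _)); apply: (le_trans (lerD (cabsD_le _ _) (lexx _))).
rewrite !(cabsM, cabsX) !cabs_conj.
have Na := cabs_ge0 a.
(* The images of the kernels are bounded by 2 since |a| <= 1/2; the three terms contribute 1, 1 and
   2 times |a|^2. *)
have -> : 4 * cabs a ^+ 2 = cabs a * cabs a * 1 +
    (1 / 2) * (cabs a * cabs a) * 2 + cabs a * cabs a * 2.
  by field.
have Na2 : 0 <= cabs a * cabs a by exact: mulr_ge0.
apply: lerD; [apply: lerD|].
- exact: ler_wpM2l.
- apply: ler_pM (GT _); rewrite ?cabs_ge0 ?mulr_ge0//.
  exact: ler_wpM2r.
- exact: ler_wpM2l.
Qed.

Lemma radial_estimate (a : C) k (f : X) (t : R) (l m0 m1 m2 : C) :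
  (forall z, cabs z < 1 ->
    cabs (T f z - (a * u k z - u k.+1 z - a^* * u k.+2 z)) <= 4 * cabs a ^+ 2) ->
  radial_limit (T f) t l -> cabs l = 1 ->
  radial_limit (u k) t m0 -> radial_limit (u k.+1) t m1 -> radial_limit (u k.+2) t m2 ->
  `|cabs (a * m0 - m1 - a^* * m2) - 1| <= 4 * cabs a ^+ 2.
Proof.
move=> fP fl l1 h0 h1 h2.
have cB := radial_limitB fl (radial_limitB (radial_limitB
  (radial_limitM (@radial_limit_cst R a t) h0) h1)
  (radial_limitM (@radial_limit_cst R a^* t) h2)).
have bound : cabs (l - (a * m0 - m1 - a^* * m2)) <= 4 * cabs a ^+ 2.
  apply: (cvgC_le _ cB); have := near_left_disc t.
  by apply: filterS => r /fP.
have -> : cabs (a * m0 - m1 - a^* * m2) - 1 = cabs (a * m0 - m1 - a^* * m2) - cabs l.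
  by rewrite l1.
rewrite ler_norml lerNl opprB; apply/andP; split.
  by apply: le_trans bound; exact: cabs_lerB.
by apply: le_trans bound; rewrite [leRHS]cabs_distC; exact: cabs_lerB.
Qed.

(** Each test function brings its own null set, so the parameters run through the two sequences
    [s j] and [i s j] only. Conjugation fixes the first and changes the sign of the second; hence
    the difference and the sum of [m0] and [m2] that [unimodular_geometric] expects. *)
Lemma boundary_recurrence k :
  {ae mu, forall t, t \in `[0, 2 * pi[ -> exists m0 m1 m2,
    [/\ radial_limit (u k) t m0, radial_limit (u k.+1) t m1,
        radial_limit (u k.+2) t m2 & m0 * m2 = m1 ^+ 2]}.
Proof.
pose s (j : nat) : R := j.+2%:R^-1.
have s0 j : 0 < s j by rewrite invr_gt0.
have s12 j : s j <= 1 / 2 by rewrite /s mul1r lef_pV2 ?posrE// ler_nat.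
have N1s j : cabs (s j)%:C = s j by rewrite cabs_real gtr0_norm.
have N2s j : cabs ((s j)%:C * 'i%C) = s j by rewrite cabsM cabs_i mulr1.
have /choice[f1 f1P] : forall j, exists f : X, inner (T f) /\ forall z, cabs z < 1 ->
    cabs (T f z - ((s j)%:C * u k z - u k.+1 z - ((s j)%:C)^* * u k.+2 z))
      <= 4 * cabs (s j)%:C ^+ 2.
  move=> j; have [|f fi fP] := @blaschke_image (s j)%:C k; first by rewrite N1s.
  by exists f.
have /choice[f2 f2P] : forall j, exists f : X, inner (T f) /\ forall z, cabs z < 1 ->
    cabs (T f z - (((s j)%:C * 'i%C) * u k z - u k.+1 z - ((s j)%:C * 'i%C)^* * u k.+2 z))
      <= 4 * cabs ((s j)%:C * 'i%C) ^+ 2.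
  move=> j; have [|f fi fP] := @blaschke_image ((s j)%:C * 'i%C) k; first by rewrite N2s.
  by exists f.
have ae1 : {ae mu, forall t, forall j, t \in `[0, 2 * pi[ ->
    exists2 l, radial_limit (T (f1 j)) t l & cabs l = 1}.
  by apply/ae_foralln => j; exact: (inner_radial (proj1 (f1P j))).
have ae2 : {ae mu, forall t, forall j, t \in `[0, 2 * pi[ ->
    exists2 l, radial_limit (T (f2 j)) t l & cabs l = 1}.
  by apply/ae_foralln => j; exact: (inner_radial (proj1 (f2P j))).
have aem j := inner_radial (inner_monomial j).
have := ae_and (ae_and ae1 ae2) (ae_and (aem k) (ae_and (aem k.+1) (aem k.+2))).
apply: ae_sub => t [[H1 H2] [H3 [H4 H5]]] tp.
have [m0 h0 n0] := H3 tp; have [m1 h1 n1] := H4 tp; have [m2 h2 n2] := H5 tp.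
exists m0, m1, m2; split=> //.
apply: unimodular_geometric n0 n1 n2 _ _ => j; cbv zeta; rewrite -/(s j).
  have [l fl l1] := H1 j tp.
  have := radial_estimate (proj2 (f1P j)) fl l1 h0 h1 h2.
  have -> : (s j)%:C^* = (s j)%:C by exact: conjc_real.
  rewrite N1s.
  by have -> : (s j)%:C * (m0 - m2) - m1 = (s j)%:C * m0 - m1 - (s j)%:C * m2 by ring.
have [l fl l1] := H2 j tp.
have := radial_estimate (proj2 (f2P j)) fl l1 h0 h1 h2.
rewrite N2s.
have -> : ((s j)%:C * 'i%C)^* = - ((s j)%:C * 'i%C).
  rewrite -[LHS]/(conjc _).
  by apply/eqP; rewrite eq_complex /=; apply/andP; split; apply/eqP; ring.
by have -> : (s j)%:C * ('i%C * (m0 + m2)) - m1 =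
  (s j)%:C * 'i%C * m0 - m1 - - ((s j)%:C * 'i%C) * m2 by ring.
Qed.

Lemma boundary_powers :
  {ae mu, forall t, t \in `[0, 2 * pi[ -> exists m : nat -> C,
    forall k, [/\ radial_limit (u k) t (m k), cabs (m k) = 1 &
      m k * m 0%N ^+ k = m 1%N ^+ k * m 0%N]}.
Proof.
have ae1 : {ae mu, forall t, forall k, t \in `[0, 2 * pi[ -> exists m0 m1 m2,
    [/\ radial_limit (u k) t m0, radial_limit (u k.+1) t m1,
        radial_limit (u k.+2) t m2 & m0 * m2 = m1 ^+ 2]}.
  by apply/ae_foralln => k; exact: boundary_recurrence.
have ae2 : {ae mu, forall t, forall k, t \in `[0, 2 * pi[ ->
    exists2 l, radial_limit (u k) t l & cabs l = 1}.
  by apply/ae_foralln => k; exact: (inner_radial (inner_monomial k)).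
apply: ae_sub (ae_and ae1 ae2) => t [H1 H2] tp.
have /choice[m mP] : forall k, exists l, radial_limit (u k) t l /\ cabs l = 1.
  by move=> k; have [l h n] := H2 k tp; exists l.
have rec k : m k * m k.+2 = m k.+1 ^+ 2.
  have [m0 [m1 [m2 [h0 h1 h2 E]]]] := H1 k tp.
  rewrite (cvgC_unique _ (proj1 (mP k)) h0) (cvgC_unique _ (proj1 (mP k.+1)) h1).
  by rewrite (cvgC_unique _ (proj1 (mP k.+2)) h2).
have m0 k : m k != 0 by rewrite -cabs_gt0 (proj2 (mP k)).
exists m => k; split; [exact: (proj1 (mP k))|exact: (proj2 (mP k))|].
exact: geometric_recurrence.
Qed.

Lemma monomial_powers k z : cabs z < 1 -> u k z * u 0%N z ^+ k = u 1%N z ^+ k * u 0%N z.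
Proof.
move=> z1; apply/eqP; rewrite -subr_eq0; apply/eqP.
pose h z := u k z * u 0%N z ^+ k - u 1%N z ^+ k * u 0%N z.
have d j := @hol_derivable R (u j).
apply: (@boundary_zero R h 2 _ _ _ z z1).
- move=> w w1; apply: derivableCB.
    by apply: derivableCM; [exact: d|apply: derivableCX; exact: d].
  by apply: derivableCM; [apply: derivableCX; exact: d|exact: d].
- move=> w w1; have b j : cabs (u j w) <= 1 by exact: (inner_bound (inner_monomial j) w1).
  have b' j n : cabs (u j w ^+ n) <= 1 by rewrite cabsX exprn_ile1// cabs_ge0.
  apply: (le_trans (cabsB_le _ _)); rewrite (_ : 2 = 1 + 1)//.
  by apply: lerD; rewrite cabsM mulr_ile1 ?cabs_ge0.
apply: ae_sub boundary_powers => t H /H[m mP].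
have c j := let: And3 x _ _ := mP j in x.
have E : m k * m 0%N ^+ k = m 1%N ^+ k * m 0%N by have [] := mP k.
have -> : 0 = m k * m 0%N ^+ k - m 1%N ^+ k * m 0%N :> C by rewrite E subrr.
exact: (radial_limitB (radial_limitM (c k) (radial_limitX (n := k) (c 0%N)))
  (radial_limitM (radial_limitX (n := k) (c 1%N)) (c 0%N))).
Qed.

Lemma composition_symbol : exists phi : hol R,
  [/\ inner phi, forall z, cabs z < 1 -> cabs (phi z) <= 1 &
      forall k z, cabs z < 1 -> u k z = u 0%N z * phi z ^+ k].
Proof.
have [b b1 ub] := inner_neq0 (inner_monomial 0).
have d j := @hol_derivable R (u j).
(* If the quotient q had modulus greater than 1 at [z], then u_n = u_0 q^n and |u_n| <= 1 would give
   |u_0| <= |q|^(-n) for all n, hence u_0 = 0 at [z]. *)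
have q1 z : cabs z < 1 -> u 0%N z != 0 -> cabs (u 1%N z / u 0%N z) <= 1.
  move=> z1 u0; rewrite leNgt; apply/negP => q1.
  have Nu0 : 0 < cabs (u 0%N z) by rewrite cabs_gt0.
  suff : cabs (u 0%N z) <= 0 by rewrite leNgt Nu0.
  apply: (@exp_arbitrarily_small _ (cabs (u 1%N z / u 0%N z))^-1 1).
    by rewrite invr_ge0 cabs_ge0/= invf_lt1// (lt_trans _ q1).
  move=> n; rewrite mul1r exprVn -[leRHS]mul1r ler_pdivlMr; last first.
    by rewrite exprn_gt0// (lt_trans _ q1).
  rewrite -cabsX -cabsM (_ : _ * _ = u n z); first exact: (inner_bound (inner_monomial n) z1).
  apply: (mulIf (expf_neq0 n u0)); rewrite monomial_powers// exprMn exprVn.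
  by field; exact: expf_neq0.
have [phi0 [dphi phi1 phiE]] := removable_quotient (d 0%N) (d 1%N) b1 ub q1.
have [phi phi_eq] := hol_extend dphi.
have phi_le z : cabs z < 1 -> cabs (phi z) <= 1 by move=> z1; rewrite phi_eq//; exact: phi1.
have lim_phi (t : R) (m0 m1 : C) : radial_limit (u 0%N) t m0 -> radial_limit (u 1%N) t m1 ->
    m0 != 0 -> radial_limit phi t (m1 / m0).
  move=> h0 h1 m00.
  have H := radial_limitM h1 (radial_limitV m00 h0).
  apply: cvg_trans H; apply: near_eq_cvg.
  have m0p : 0 < cabs m0 by rewrite cabs_gt0.
  (* [phi] is known to be the quotient only where u_0 does not vanish; on this radius that is the
     case near the circle, the limit of u_0 being nonzero. *)
  have nz : \forall r \near (1 : R)^'-, cabs (u 0%N (r%:C * cis t) - m0) < cabs m0.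
    by move/cvgC_cabsP : h0; apply.
  apply: filterS (filterI (near_left_disc t) nz) => r [r1 rn].
  rewrite phi_eq// phiE//; apply/eqP => r0; move: rn.
  by rewrite r0 sub0r cabsN ltxx.
exists phi; split => //.
- split; first by exists 1 => z /discP z1; rewrite normr_cabs lecR; exact: phi_le.
  apply: ae_sub boundary_powers => t H /H[m mP].
  have [h0 n0 _] := mP 0%N; have [h1 n1 _] := mP 1%N.
  exists (m 1%N / m 0%N).
    by apply: lim_phi => //; rewrite -cabs_gt0 n0.
  by rewrite normr_cabs cabsM cabsV n0 n1 invr1 mulr1.
(* Dividing [monomial_powers] by a power of u_0 would leave out its zeros, so the identity is
   checked on the circle, where u_0 has unimodular limits. *)
move=> k z z1; apply/eqP; rewrite -subr_eq0; apply/eqP.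
apply: (@boundary_zero R (fun z => u k z - u 0%N z * phi z ^+ k) 2 _ _ _ z z1).
- move=> w w1; apply: derivableCB; first exact: d.
  by apply: derivableCM; [exact: d|apply: derivableCX; exact: hol_derivable].
- move=> w w1; have b' j : cabs (u j w) <= 1 by exact: (inner_bound (inner_monomial j) w1).
  apply: (le_trans (cabsB_le _ _)); rewrite (_ : 2 = 1 + 1)//; apply: lerD => //.
  by rewrite cabsM mulr_ile1 ?cabs_ge0// cabsX exprn_ile1 ?cabs_ge0// phi_le.
apply: ae_sub boundary_powers => t H /H[m mP].
have [h0 n0 _] := mP 0%N; have [h1 n1 _] := mP 1%N; have [hk nk E] := mP k.
have m00 : m 0%N != 0 by rewrite -cabs_gt0 n0.
have -> : 0 = m k - m 0%N * (m 1%N / m 0%N) ^+ k :> C.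
  apply/eqP; rewrite eq_sym subr_eq0; apply/eqP.
  apply: (mulIf (expf_neq0 k m00)); rewrite E exprMn exprVn.
  by field; exact: expf_neq0.
exact: (radial_limitB hk
  (radial_limitM h0 (radial_limitX (n := k) (lim_phi _ _ _ h0 h1 m00)))).
Qed.

End Operator.

(** * The theorem *)

Section Extension.
Variable R : realType.
Local Notation C := R[i].

(** Compactness of a square containing the disc of radius 2, applied to the discs of radius
    [1 + n.+1%:R^-1]: near a point of the closed disc membership in [U] is an open condition, and
    near any other point these discs are eventually avoided. *)
Lemma open_disc_radius (U : set C) : open U -> @closed_disc R `<=` U ->
  exists2 rho : R, 1 < rho & forall z, cabs z < rho -> U z.
Proof.
move=> oU cU.
pose p (x : R * R) : C := x.1 +i* x.2.
have cp (x : R * R) : p @ x --> p x.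
  by apply: cvgC_pair; [exact: cvg_fst|exact: cvg_snd].
pose K : set (R * R) := `[(-2 : R), 2] `*` `[(-2 : R), 2].
have cK : compact K by apply: compact_setX; exact: segment_compact.
pose P (n : nat) (x : R * R) := cabs (p x) < 1 + n.+1%:R^-1 -> U (p x).
have : \forall n \near \oo, K `<=` P n.
  apply: ((compact_near_coveringP K).1 cK _ \oo P) => x _.
  have [x1|x1] := leP (cabs (p x)) 1.
    have : \forall y \near x, U (p y).
      have Ux : nbhs (p x) U.
        apply: open_nbhs_nbhs; split=> //.
        by apply: cU; rewrite /closed_disc /= normr_cabs lecR.
      exact: (cp x _ Ux).
    move=> H; exists ([set y | U (p y)], setT); first by split=> //; exact: filterT.
    by move=> [y n] [/= h _] _.
  pose d := (cabs (p x) - 1) / 2.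
  have d0 : 0 < d by rewrite divr_gt0// subr_gt0.
  have h1 : \forall y \near x, cabs (p y - p x) < d.
    exact: ((@cvgC_cabsP R _ (nbhs x) (nbhs_filter x) _ _).1 (cp x) _ d0).
  have h2 : \forall n \near \oo, n.+1%:R^-1 < d.
    have := @cvg_harmonic R => /cvgrPdist_lt /(_ _ d0).
    by apply: filterS => n; rewrite sub0r normrN ger0_norm// invr_ge0.
  exists ([set y | cabs (p y - p x) < d], [set n | n.+1%:R^-1 < d]); first by split.
  move=> [y n] [/= g1 g2] g3; exfalso.
  have := cabs_lerB (p x) (p y); rewrite cabs_distC; move: g1 g2 g3 x1; rewrite /d.
  move: (cabs (p x)) (cabs (p y)) (cabs (p y - p x)) n.+1%:R^-1 => a b c v; lra.
move=> [n _ /(_ n (leqnn n)) nP].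
exists (1 + n.+1%:R^-1); first by rewrite ltrDl invr_gt0.
move=> z zn; have z2 : cabs z <= 2.
  have : n.+1%:R^-1 <= 1 :> R by rewrite invf_le1// ler1n.
  by move: zn; move: (cabs z) n.+1%:R^-1 => a b; lra.
have pE : z = p (complex.Re z, complex.Im z) by case: (z).
rewrite pE; apply: nP; last by rewrite -pE.
have := le_trans (cabs_ge_Re z) z2; have := le_trans (cabs_ge_Im z) z2.
by split; rewrite /= in_itv /= -ler_norml.
Qed.

Lemma taylor_cvg (f : C -> C) (rho r : R) :
  (forall z, cabs z < rho -> derivable f z 1) -> 0 < r < rho ->
  exists c M, [/\ 0 <= M, forall k, cabs (c k) <= M * (r^-1) ^+ k &
    forall z, cabs z < r -> (fun n => \sum_(k < n) c k * z ^+ k) @ \oo --> f z].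
Proof.
move=> df rr; have [c [M [M0 cM H]]] := taylor df rr.
have /andP[r0 _] := rr.
exists c, M; split=> //; first by move=> k; rewrite exprVn; exact: cM.
move=> z zr; apply/cvgC_cabsP => e e0.
have q0 : 0 <= cabs z / r by rewrite divr_ge0 ?cabs_ge0// ltW.
have cv : (fun n => M * (r / (r - cabs z)) * (cabs z / r) ^+ n) @ \oo -->
    M * (r / (r - cabs z)) * 0.
  apply: cvgM; first exact: cvg_cst.
  by apply: cvg_expr; rewrite ger0_norm// ltr_pdivrMr// mul1r.
rewrite mulr0 in cv; move/cvgrPdist_lt : cv => /(_ _ e0).
apply: filterS => n; rewrite sub0r normrN => h.
rewrite cabs_distC; apply: (le_lt_trans (H n z zr)); rewrite mulrAC.
exact: (le_lt_trans (ler_norm _) h).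
Qed.

End Extension.

(** * Dimension and linear dependence *)

Section Dimension.
Variables (R : realType) (V : lmodType R[i]) (A : set V).

Lemma dimension_gt1 : (1 < dimension A)%E -> exists (n : nat) (v : 'I_n.+2 -> V),
  (forall i, A (v i)) /\ linearly_independent v.
Proof.
move=> /ereal_sup_gt[_ [n [v vP] <-]]; rewrite lte_fin ltr1n.
by case: n v vP => [|[|n]] // v vP _; exists n, v.
Qed.

Lemma dimension_ge (n : nat) (v : 'I_n -> V) : (forall i, A (v i)) ->
  linearly_independent v -> ((n%:R)%:E <= dimension A)%E.
Proof.
by move=> vA vi; apply: ereal_sup_ubound; exists n => //; exists v.
Qed.

Lemma collinear_dependent (n : nat) (v : 'I_n.+2 -> V) (w : V) (l : 'I_n.+2 -> R[i]) :
  (forall i, v i = l i *: w) -> ~ linearly_independent v.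
Proof.
move=> vl vi; pose i0 : 'I_n.+2 := ord0; pose i1 : 'I_n.+2 := lift ord0 ord0.
have i10 : i1 != i0 by [].
have l0 : l i0 = 0.
  (* The relation l_1 v_0 - l_0 v_1 = 0 forces l_0 = 0; then v_0 = 0, which the second choice of
     coefficients contradicts. *)
  pose c i := if i == i0 then l i1 else if i == i1 then - l i0 else 0.
  have := vi c; rewrite (bigD1 i0)//= (bigD1 i1)//= big1; last first.
    by move=> i /andP[h1 h2]; rewrite /c (negPf h1) (negPf h2) scale0r.
  rewrite /c eqxx (negPf i10) eqxx !vl !scalerA addr0 -scalerDl.
  rewrite mulNr mulrC subrr scale0r => /(_ erefl i1).
  by rewrite (negPf i10) eqxx => /eqP; rewrite oppr_eq0 => /eqP.
pose c i : R[i] := if i == i0 then 1 else 0.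
have := vi c; rewrite (bigD1 i0)//= big1; last first.
  by move=> i h1; rewrite /c (negPf h1) scale0r.
rewrite /c eqxx vl l0 scale0r scaler0 addr0 => /(_ erefl i0).
by rewrite eqxx => /eqP; rewrite oner_eq0.
Qed.

End Dimension.

Theorem theorem1p1 (R : realType) (X : completeNormedModType R[i])
    (inc : {linear X -> hol R}) (hX : banach_hol_space inc)
    (T : {linear X -> hol R}) (T_continuous : continuous T)
    (T_blaschke : forall f : X, finite_blaschke (inc f) -> inner (T f)) :
  ((1 < dimension (range T))%E ->
     exists phi psi : hol R,
       [/\ inner phi, inner psi, ~ constant_on_disc phi,
           (forall z, disc z -> disc (phi z)) &
           forall (f : X) z, disc z -> T f z = psi z * inc f (phi z)]) /\
  (dimension (range T) = 1%E ->
     exists (psi : hol R) (alpha : R[i]),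
       [/\ inner psi, `|alpha| = 1 &
           forall (f : X) (g : R[i] -> R[i]),
             holomorphic_extension (inc f) g ->
             forall z, disc z -> T f z = g alpha * psi z]).
Proof.
have [e eP] := monomials hX.
have [phi [phi_inner phi_le phiE]] :=
  composition_symbol hX T_continuous T_blaschke eP.
have innerT k := inner_monomial T_blaschke eP k.
have psi_inner := innerT 0%N; set psi := T (e 0%N) in phiE psi_inner *.
have [b b1 psib] := inner_neq0 psi_inner.
have T_poly f p z : is_polynomial (inc f) p -> cabs z < 1 -> T f z = psi z * p.[phi z].
  move=> fp z1; rewrite (polynomialE hX eP fp).
  rewrite (lin_eval_sum T (size p) (fun j => p`_j) e z) horner_coef mulr_sumr.
  by apply: eq_bigr => i _; rewrite phiE// mulrCA.
have T_eval z f : cabs z < 1 -> (fun g : X => T g z) @ f --> T f z.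
  by move=> z1; exact: lin_eval_continuous.
have cstC (Y : Type) (F : set_system Y) (FF : Filter F) (c : R[i]) :
  (fun=> c) @ F --> c by exact: cvgC_cst.
(* Either [phi] maps the disc into itself, or it reaches modulus 1 and is a unimodular constant by
   the maximum principle. The first case is incompatible with dimension 1 and the second with
   dimension greater than 1. *)
have [phi_lt|] := pselect (forall z, cabs z < 1 -> cabs (phi z) < 1).
  split=> [_|dim1].
    exists phi, psi; split=> //.
    - move=> [c phic]; have := inner_radial phi_inner.
      (* A constant of modulus less than 1 has no unimodular radial limit; as for [inner_neq0], this
         contradiction at almost every [t] is turned into 1 = 0. *)
      move=> H; suff : (1 : R[i]) = 0 by move/eqP; rewrite oner_eq0.
      have c1 : cabs c < 1 by rewrite -(phic 0) ?phi_lt ?cabs0//; apply/discP; rewrite cabs0.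
      have d1 : hol_disc (fun=> 1 : R[i]) by move=> z _; exact: derivableC_cst.
      apply: (@boundary_zero R (fun=> 1) 1 d1 _ _ 0); last by rewrite cabs0.
        by move=> z _; rewrite cabs1.
      apply: ae_sub H => t Ht /Ht[l hl l1]; exfalso.
      have hc : radial_limit phi t c.
        apply/cvgC_cabsP => eps eps0; have := near_left_disc t.
        by apply: filterS => r /discP /phic ->; rewrite subrr cabs0.
      by move: l1; rewrite (cvgC_unique _ hl hc) => cE; rewrite cE ltxx in c1.
    - by move=> z /discP z1; apply/discP; exact: phi_lt.
    - move=> f z /discP z1; pattern f; set Q := (Q in Q f); move: f.
      apply: (@poly_agree R X inc hX (fun f => T f z) (fun f => psi z * inc f (phi z))).
      + by move=> f; exact: T_eval.
      + move=> f; apply: cvgCM; first exact: cstC.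
        by apply: lin_eval_continuous; [exact: inc_continuous hX|exact: phi_lt].
      + by move=> f p fp; rewrite (T_poly f p)// fp//; apply/discP; exact: phi_lt.
  (* The images of 1 and z are [psi] and [psi] times [phi]; their independence already gives
     dimension at least 2. *)
  exfalso; pose v (i : 'I_2) := T (e i).
  suff vi : linearly_independent v.
    have vT i : range T (v i) by exists (e i).
    by have := dimension_ge vT vi; rewrite dim1 lee_fin lern1.
  move=> c; rewrite !big_ord_recl big_ord0 addr0 /v /= => H.
  have {}H z : c ord0 * psi z + c (lift ord0 ord0) * T (e 1%N) z = 0.
    by have := congr1 (fun h : hol R => h z) H.
  set c0 := c ord0 in H *; set c1 := c _ in H *.
  (* On the circle both functions are unimodular, so a relation between them forces coefficients of
     equal modulus. At [b], where [psi] does not vanish, the same relation reads c0 = - c1 phi(b)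
     with |phi(b)| < 1, which is then possible only for zero coefficients. *)
  have Nc : cabs c0 = cabs c1.
    suff : (cabs c0 - cabs c1)%:C = 0 :> R[i] by move/complexI/eqP; rewrite subr_eq0 => /eqP.
    have d1 : hol_disc (fun=> (cabs c0 - cabs c1)%:C : R[i]).
      by move=> z _; exact: derivableC_cst.
    apply: (@boundary_zero R (fun=> _) (cabs (cabs c0 - cabs c1)%:C) d1 _ _ 0);
      last by rewrite cabs0.
      by move=> z _; exact: lexx.
    have := ae_and (inner_radial (innerT 0%N)) (inner_radial (innerT 1%N)).
    apply: ae_sub => t [H0 H1] tp.
    have [m0 h0 n0] := H0 tp; have [m1 h1 n1] := H1 tp.
    have hs := radial_limitB (radial_limitM (@radial_limit_cst R c0 t) h0)
      (radial_limitM (@radial_limit_cst R (- c1) t) h1).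
    have hz : radial_limit (fun z => c0 * psi z - - c1 * T (e 1%N) z) t 0.
      apply/cvgC_cabsP => eps eps0; apply: nearW => r.
      by rewrite mulNr opprK H subrr cabs0.
    have E : c0 * m0 = - c1 * m1.
      by apply/eqP; rewrite -subr_eq0; apply/eqP; exact: (cvgC_unique _ hs hz).
    have : cabs (c0 * m0) = cabs (- c1 * m1) by rewrite E.
    rewrite !cabsM cabsN n0 n1 !mulr1 => ->.
    by rewrite subrr; exact: radial_limit_cst.
  have c10 : c1 = 0.
    apply/eqP; apply: contraT => c1n.
    have := H b; rewrite phiE// expr1 mulrCA -[c0 * _]mulrC -mulrDr => /eqP.
    rewrite mulf_eq0 (negPf psib)/= addr_eq0 => /eqP c0E.
    have : cabs c0 = cabs c1 * cabs (phi b) by rewrite c0E cabsN cabsM.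
    rewrite Nc => E; have : cabs c1 * cabs (phi b) < cabs c1.
      by rewrite gtr_pMr ?cabs_gt0// phi_lt.
    by rewrite -E ltxx.
  have c00 : c0 = 0 by apply/eqP; rewrite -cabs_eq0 Nc c10 cabs0.
  by move=> i; case: (unliftP ord0 i) => [j ->|->]; rewrite ?(ord1 j).
move=> /existsNP[a /not_implyP[a1 /negP]]; rewrite -leNgt => phia.
have {}phia : cabs (phi a) = 1 by apply/eqP; rewrite eq_le phi_le.
have phi_cst := max_principle (@hol_derivable R phi) phi_le a1 phia.
set alpha := phi a in phia phi_cst.
have uE k z : cabs z < 1 -> T (e k) z = psi z * alpha ^+ k.
  by move=> z1; rewrite phiE// phi_cst.
split=> [dim|_].
  exfalso; have [n [v [vT vi]]] := dimension_gt1 dim.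
  (* On polynomials T f = p(alpha) psi, but f(alpha) has no meaning for a general [f] in X. The
     value of T f at [b] stands in for it: the resulting identity is continuous in [f] and extends
     by density. *)
  have collinear f : T f = (T f b / psi b) *: psi.
    apply: hol_eq => z z1.
    have -> : ((T f b / psi b) *: psi) z = T f b * psi z / psi b by rewrite mulrAC.
    apply: (mulIf psib); rewrite divfK//.
    pattern f; set Q := (Q in Q f); move: f.
    apply: (@poly_agree R X inc hX (fun f => T f z * psi b) (fun f => T f b * psi z)).
    + by move=> f; apply: cvgCM; [exact: T_eval|exact: cstC].
    + by move=> f; apply: cvgCM; [exact: T_eval|exact: cstC].
    + move=> f p fp; rewrite !(T_poly f p)// !phi_cst//; ring.
  apply: (@collinear_dependent R _ n v psi (fun i => v i b / psi b)) vi => i.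
  by have [f _ <-] := vT i; exact: collinear.
exists psi, alpha; split=> //; first by rewrite normr_cabs phia.
move=> f g [[U [oU cU hU]] fg] z /discP z1.
have [rho rho1 rhoU] := open_disc_radius oU cU.
(* Strictly between 1 and [rho]: the Taylor coefficients of [g] then decay like [r^-1 ^+ k], fast
   enough for the series to converge in X, and [alpha] lies in the open disc of radius [r]. *)
pose r := (1 + rho) / 2.
have r1 : 1 < r by rewrite /r; lra.
have rr : 0 < r < rho by rewrite (lt_trans ltr01 r1)/= /r; lra.
have dg w : cabs w < rho -> derivable g w 1 by move=> /rhoU; exact: hU.
have [c [M [M0 cM cg]]] := taylor_cvg dg rr.
have q01 : 0 <= r^-1 < 1.
  by rewrite invr_ge0 (ltW (lt_trans ltr01 r1)) invf_lt1 ?(lt_trans ltr01 r1).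
(* The Taylor series has a sum [h] in X, which is [f] because [inc] is injective; [T] may therefore
   be applied term by term. *)
have [h hP] := power_series_mem hX eP 0 M0 q01 cM.
have hf : h = f.
  apply: (inc_injective hX); apply: hol_eq => w w1.
  rewrite fg; last exact/discP.
  apply: (cvgC_unique _ (hP inc w (inc_continuous hX) w1)).
  have -> : (fun n => \sum_(j < n) c j * inc (e (0 + j)%N) w) =
      fun n => \sum_(j < n) c j * w ^+ j.
    by apply/funext => n; apply: eq_bigr => j _; rewrite (inc_monomial eP).
  by apply: cg; exact: lt_trans r1.
have := hP T z T_continuous z1; rewrite hf.
have -> : (fun n => \sum_(j < n) c j * T (e (0 + j)%N) z) =
    fun n => (\sum_(j < n) c j * alpha ^+ j) * psi z.
  apply/funext => n; rewrite mulr_suml; apply: eq_bigr => j _.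
  by rewrite uE// -mulrA [_ * psi z]mulrC.
move=> lT; apply: (cvgC_unique _ lT).
apply: cvgCM; last exact: cstC.
by apply: cg; rewrite phia.
Qed.
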